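(* Let $G=(V,\mathcal E,w)$ be an undirected, connected, weighted graph on $n$ nodes. Let: - $E\in\mathbb R^{n\times|\mathcal E|}$ be its signed incidence matrix (arbitrary orientation); - $W=\mathrm{diag}(w(e))_{e\in\mathcal E}$; - $L=EWE^T$, with largest eigenvalue $\lambda_n$. Let $\tau\ge0$ with $\tau\lambda_n<\pi/2$. Consider the consensus network with communication channel noise $$\dot x_i=\sum_{e=\{i,j\}\in\mathcal E}a_{ij}\big(x_j(t-\tau)-x_i(t-\tau)+\xi_e(t)\big),$$ that is, $$\dot x(t)=-L\,x(t-\tau)+EW\,\xi(t),\qquad y=M_nx,$$ where $(\xi_e)_{e\in\mathcal E}$ are mutually independent zero-mean Gaussian white noises with intensities $\sigma_e^2$. Then for every link $e=\{i,j\}\in\mathcal E$, $$\nu_e=\frac12\,w(e)^2\,r_e\Big(L\cos(\tau L)^{-1}\big(M_n-\sin(\tau L)\big)\Big).$$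
   Context: Notation: - $a_{ij}=w(\{i,j\})$. - $M_n=I_n-\frac1n\mathbf1\mathbf1^T$. - $X^\dagger$ is the Moore–Penrose pseudo-inverse. - $\cos(X)$ and $\sin(X)$ are the matrix power-series functions; $\cos(\tau L)$ is invertible since $\tau\lambda_n<\pi/2$. - For a symmetric matrix $X$ and $e=\{i,j\}$, $r_e(X)=[X^\dagger]_{ii}+[X^\dagger]_{jj}-2[X^\dagger]_{ij}$. The performance is $$\rho_{ss}=\lim_{t\to\infty}\mathbb E[y^Ty]=\frac1{2\pi}\int\mathrm{Tr}[G(j\omega)^HG(j\omega)]d\omega,\qquad G(s)=M_n(sI+e^{-\tau s}L)^{-1}EW\,\mathrm{diag}(\sigma_e).$$ The link centrality is $\nu_e=\partial\rho_{ss}/\partial\sigma_e^2$. *)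

(* Defs.v *)
From HB Require Import structures.
From mathcomp Require Import all_boot all_order all_algebra.
From mathcomp Require Import all_classical all_reals all_analysis.
From mathcomp Require Import complex.
Set Implicit Arguments. Unset Strict Implicit. Unset Printing Implicit Defensive.
Import Order.TTheory GRing.Theory Num.Theory.
Import numFieldNormedType.Exports.
Local Open Scope classical_set_scope.
Local Open Scope ring_scope.

Section Defs.
Variable R : realType.

(* A weighted undirected graph on nodes 'I_n with m links; link k joins
   src k and dst k (the pair (src k, dst k) fixes an arbitrary orientation). *)

Definition adjacent (n m : nat) (src dst : 'I_m -> 'I_n) : rel 'I_n :=
  fun i j => [exists k, ((src k == i) && (dst k == j)) || ((src k == j) && (dst k == i))].

Definition simple_graph (n m : nat) (src dst : 'I_m -> 'I_n) : Prop :=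
  (forall k, src k != dst k) /\
  (forall k l, [set src k; dst k] = [set src l; dst l] -> k = l).

Definition connected_graph (n m : nat) (src dst : 'I_m -> 'I_n) : Prop :=
  forall i j : 'I_n, connect (adjacent src dst) i j.

Definition incidence (n m : nat) (src dst : 'I_m -> 'I_n) : 'M[R]_(n, m) :=
  \matrix_(i, k) ((i == src k)%:R - (i == dst k)%:R).

Definition weightmx (m : nat) (w : 'I_m -> R) : 'M[R]_m := diag_mx (\row_k w k).

Definition laplacian (n m : nat) (src dst : 'I_m -> 'I_n) (w : 'I_m -> R) : 'M[R]_n :=
  incidence src dst *m weightmx w *m (incidence src dst)^T.

Definition centering (n : nat) : 'M[R]_n := 1%:M - n%:R^-1 *: const_mx 1.

Definition mxcos (n : nat) (X : 'M[R]_n) : 'M[R]_n :=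
  limn (series (fun k : nat => ((-1) ^+ k / (2 * k)`!%:R) *: X ^+ (2 * k))).

Definition mxsin (n : nat) (X : 'M[R]_n) : 'M[R]_n :=
  limn (series (fun k : nat => ((-1) ^+ k / (2 * k).+1`!%:R) *: X ^+ (2 * k).+1)).

Definition is_mp_pinv (n : nat) (X Y : 'M[R]_n) : Prop :=
  [/\ X *m Y *m X = X, Y *m X *m Y = Y, (X *m Y)^T = X *m Y & (Y *m X)^T = Y *m X].

Definition pinv (n : nat) (X : 'M[R]_n) : 'M[R]_n := xget 0 [set Y | is_mp_pinv X Y].

Definition reff (n : nat) (X : 'M[R]_n) (i j : 'I_n) : R :=
  pinv X i i + pinv X j j - 2 * pinv X i j.

Definition cmx (p q : nat) (A : 'M[R]_(p, q)) : 'M[R[i]]_(p, q) :=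
  map_mx (fun x => x%:C%C) A.

Definition transfer (n m : nat) (src dst : 'I_m -> 'I_n) (w : 'I_m -> R)
  (tau : R) (sigma : 'I_m -> R) (om : R) : 'M[R[i]]_(n, m) :=
  let s : R[i] := (0 +i* om)%C in
  let edelay : R[i] := (cos (tau * om) +i* (- sin (tau * om)))%C (* = e^{-tau s} *) in
  cmx (centering n) *m
  invmx (s%:M + edelay *: cmx (laplacian src dst w)) *m
  cmx (incidence src dst *m weightmx w *m diag_mx (\row_k sigma k)).

(* integrand Tr[G(j w)^H G(j w)] (a real number; we take the real part) *)
Definition h2_integrand (n m : nat) (src dst : 'I_m -> 'I_n) (w : 'I_m -> R)
  (tau : R) (sigma : 'I_m -> R) (om : R) : R :=
  let G := transfer src dst w tau sigma om in
  @complex.Re R (\tr ((map_mx (@conjc R) G)^T *m G)).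

Definition rho_ss (n m : nat) (src dst : 'I_m -> 'I_n) (w : 'I_m -> R)
  (tau : R) (sigma : 'I_m -> R) : R :=
  (2 * pi)^-1 * fine (\int[@lebesgue_measure R]_(om in setT)
                        (h2_integrand src dst w tau sigma om)%:E)%E.

Definition set_intensity (m : nat) (sigma : 'I_m -> R) (e : 'I_m) (x : R) : 'I_m -> R :=
  fun k => if k == e then x else sigma k.

(* rho_ss as a function of the e-th noise intensity sigma_e^2 = t (sigma_e = sqrt t) *)
Definition rho_of_var (n m : nat) (src dst : 'I_m -> 'I_n) (w : 'I_m -> R)
  (tau : R) (sigma : 'I_m -> R) (e : 'I_m) (t : R) : R :=
  rho_ss src dst w tau (set_intensity sigma e (Num.sqrt t)).

End Defs.

(* Main.v *)
Require Import Defs.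
From HB Require Import structures.
From mathcomp Require Import all_boot all_order all_algebra.
From mathcomp Require Import all_classical all_reals all_analysis.
From mathcomp Require Import complex.
From mathcomp Require Import measurable_realfun ring lra.
Set Implicit Arguments. Unset Strict Implicit. Unset Printing Implicit Defensive.
Import Order.TTheory GRing.Theory Num.Theory.
Import numFieldNormedType.Exports.
Import ComplexField.Normc.
Local Open Scope classical_set_scope.
Local Open Scope ring_scope.

(** Diagonalising the Laplacian reduces the trace to a sum, over the positive
    eigenvalues [l], of [1 / |p(i om)|^2] with [p z = z + l e^(-tau z)], so that
    [rho_ss] is linear in the [sigma_k^2] and everything rests on
    [int 1 / |p(i om)|^2 d om = (pi / l) g], [g = cos (tau l) / (1 - sin (tau l))].

    For this integral put [S z = (l e^(-tau z) - z) / p z] and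
    [K z = (S z + g (z - l) / (z + l)) / (z^2 + l^2)].  On the imaginary axis
    [Re K = 1 / |p|^2 - g / (l^2 + om^2)], and the value of [g] is exactly the one
    that makes the singularities of [K] at [+- i l] removable.  As
    [tau l < pi / 2], [p] has no zero in the closed right half-plane; so [K] is
    holomorphic there and [O(|z|^-2)].  By the Cauchy-Riemann equations the
    integral of [Re K] along a vertical line does not depend on the line, it
    vanishes for lines going to infinity, and dominated convergence carries this
    to the imaginary axis. *)

(** * Complex calculus along real curves *)

(** The obvious holomorphic extension of [1 / |p(i om)|^2] is [1 / (p(z) p(-z))], which for
    [tau > 0] has infinitely many poles on each side of the axis. [K] keeps only the factor [p(z)],
    whose zeros all lie on the left, and carries the integrand in its real part alone. The form of
    [S] comes from the fact that [(a - b) / (a + b)] has real part [(|a|^2 - |b|^2) / |a + b|^2].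
    With [a = l e^(-tau z)] and [b = z] on the axis, [|a| = l], so the numerator is [l^2 - om^2],
    which is also the value of [z^2 + l^2] and cancels. The correction [(z - l) / (z + l)] obeys the
    same identity and costs only a Lorentzian.

    Two totalised inverses shape the statements. Since [0^-1 = 0], [K] does not take its limit value
    at [+- i l], so these points are excluded from pointwise claims and limits on the axis hold
    almost everywhere. At [om = 0] the transfer function inverts [L] itself, which is singular, so
    modal formulas are stated for [om != 0]. *)

Section ComplexCalculus.
Variable R : realType.
Local Notation C := R[i].
Local Notation Re := complex.Re.
Local Notation Im := complex.Im.
Implicit Types (g h : R -> C) (K H : C -> C) (z d : C) (t : R).

Lemma cReD z d : Re (z + d) = Re z + Re d. Proof. by case: z; case: d. Qed.
Lemma cImD z d : Im (z + d) = Im z + Im d. Proof. by case: z; case: d. Qed.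
Lemma cReN z : Re (- z) = - Re z. Proof. by case: z. Qed.
Lemma cImN z : Im (- z) = - Im z. Proof. by case: z. Qed.
Lemma cReM z d : Re (z * d) = Re z * Re d - Im z * Im d.
Proof. by case: z; case: d. Qed.
Lemma cImM z d : Im (z * d) = Re z * Im d + Im z * Re d.
Proof. by case: z => a b; case: d => c e /=; rewrite [b * c]mulrC. Qed.
Lemma cReV z : Re z^-1 = Re z * (Re z ^+ 2 + Im z ^+ 2)^-1.
Proof. by case: z. Qed.
Lemma cImV z : Im z^-1 = - (Im z * (Re z ^+ 2 + Im z ^+ 2)^-1).
Proof. by case: z. Qed.

Lemma cReMr z (a : R) : Re (z * a%:C%C) = Re z * a.
Proof. by case: z => b c /=; rewrite mulr0 subr0. Qed.

Lemma complex_eq z d : Re z = Re d -> Im z = Im d -> z = d.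
Proof. by case: z => a b; case: d => c e /= -> ->. Qed.

Lemma normcE2 z : normc z ^+ 2 = Re z ^+ 2 + Im z ^+ 2.
Proof.
by case: z => a b /=; rewrite sqr_sqrtr// addr_ge0// sqr_ge0.
Qed.

Lemma normc_ge0 z : 0 <= normc z.
Proof. by case: z => a b; exact: sqrtr_ge0. Qed.

Lemma normc_gt0 z : z != 0 -> 0 < normc z.
Proof.
move=> z0; rewrite lt0r normc_ge0 andbT; apply: contra z0 => /eqP /eq0_normc ->.
exact: eqxx.
Qed.

Lemma normc_le z (a : R) : 0 <= a -> Re z ^+ 2 + Im z ^+ 2 <= a ^+ 2 -> normc z <= a.
Proof. by move=> a0; rewrite -normcE2 ler_pXn2r// nnegrE ?normc_ge0. Qed.

Lemma le_normc z (a : R) : 0 <= a -> a ^+ 2 <= Re z ^+ 2 + Im z ^+ 2 -> a <= normc z.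
Proof. by move=> a0; rewrite -normcE2 ler_pXn2r// nnegrE ?normc_ge0. Qed.

Lemma normr_Re_le z : `|Re z| <= normc z.
Proof.
by apply: le_normc; rewrite ?normr_ge0// real_normK ?num_real// lerDl sqr_ge0.
Qed.

Lemma normr_Im_le z : `|Im z| <= normc z.
Proof.
by apply: le_normc; rewrite ?normr_ge0// real_normK ?num_real// lerDr sqr_ge0.
Qed.

Lemma normc_le_add z : normc z <= `|Re z| + `|Im z|.
Proof.
apply: normc_le; first by rewrite addr_ge0.
rewrite sqrrD !real_normK ?num_real//.
by rewrite lerD2r lerDl mulrn_wge0// mulr_ge0.
Qed.

Lemma normcB_ge z d : normc z - normc d <= normc (z + d).
Proof.
rewrite lerBlDr -(normcN d).
by apply: le_trans (le_normcD _ _); rewrite addrK.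
Qed.

Lemma normcR (a : R) : normc a%:C%C = `|a|.
Proof. by rewrite /= expr0n addr0 sqrtr_sqr. Qed.

(** Differentiating by components lets the real mean value theorem, the fundamental theorem of
    calculus and differentiation under the integral apply to each part directly. *)
Definition cderive g t d :=
  is_derive t 1 (fun s => Re (g s)) (Re d) /\
  is_derive t 1 (fun s => Im (g s)) (Im d).

Lemma cderive_cst z t : cderive (fun=> z) t 0.
Proof. by split; exact: is_derive_cst. Qed.

Lemma cderiveD g h t d e : cderive g t d -> cderive h t e ->
  cderive (fun s => g s + h s) t (d + e).
Proof.
move=> [g1 g2] [h1 h2]; split.
  under eq_fun do rewrite cReD.
  by rewrite cReD; exact: is_deriveD.
under eq_fun do rewrite cImD.
by rewrite cImD; exact: is_deriveD.
Qed.

Lemma cderiveM g h t d e : cderive g t d -> cderive h t e ->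
  cderive (fun s => g s * h s) t (d * h t + g t * e).
Proof.
move=> [g1 g2] [h1 h2]; split.
  under eq_fun do rewrite cReM.
  apply: (is_derive_eq (is_deriveB (is_deriveM g1 h1) (is_deriveM g2 h2))).
  by rewrite cReD !cReM /GRing.scale/=; ring.
under eq_fun do rewrite cImM.
apply: (is_derive_eq (is_deriveD (is_deriveM g1 h2) (is_deriveM g2 h1))).
by rewrite cImD !cImM /GRing.scale/=; ring.
Qed.

Lemma cderiveV g t d : g t != 0 -> cderive g t d ->
  cderive (fun s => (g s)^-1) t (- (d / g t ^+ 2)).
Proof.
move=> gt0 [g1 g2].
have n0 : Re (g t) ^+ 2 + Im (g t) ^+ 2 != 0.
  by rewrite -normcE2 expf_neq0// gt_eqF// normc_gt0.
have dn : is_derive t 1 (fun s => Re (g s) ^+ 2 + Im (g s) ^+ 2)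
    (2 * (Re (g t) * Re d + Im (g t) * Im d)).
  under eq_fun do rewrite !expr2.
  apply: (is_derive_eq (is_deriveD (is_deriveM g1 g1) (is_deriveM g2 g2))).
  by rewrite /GRing.scale/=; ring.
have dnV := @is_deriveV R (fun s => Re (g s) ^+ 2 + Im (g s) ^+ 2) t _ 1 n0 dn.
rewrite expr2 /cderive; split.
  under eq_fun do rewrite cReV.
  apply: (is_derive_eq (is_deriveM g1 dnV)).
  rewrite cReN cReM cReV cImV cReM cImM /GRing.scale/=.
  field.
  (* The side condition left by [field] is the expanded squared modulus of [g t * g t], that is, the
     square of the squared modulus of [g t]. *)
  rewrite n0 /= -[X in X != 0](_ : (Re (g t) ^+ 2 + Im (g t) ^+ 2) ^+ 2 = _).
    by rewrite expf_neq0.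
  by ring.
under eq_fun do rewrite cImV.
apply: (is_derive_eq (is_deriveN (is_deriveM g2 dnV))).
rewrite cImN cImM cReV cImV cReM cImM /GRing.scale/=.
field.
rewrite n0 /= -[X in X != 0](_ : (Re (g t) ^+ 2 + Im (g t) ^+ 2) ^+ 2 = _).
  by rewrite expf_neq0.
by ring.
Qed.

Definition cexp z : C := ((expR (Re z) * cos (Im z)) +i* (expR (Re z) * sin (Im z)))%C.

Lemma cderive_exp g t d : cderive g t d ->
  cderive (fun s => cexp (g s)) t (cexp (g t) * d).
Proof.
move=> [g1 g2].
have de : is_derive t 1 (fun s => expR (Re (g s))) (Re d * expR (Re (g t))).
  by apply: (is_derive_eq (is_derive1_comp (is_derive_expR _) g1)); rewrite /GRing.scale/= mulrC.
have dc : is_derive t 1 (fun s => cos (Im (g s))) (- (Im d * sin (Im (g t)))).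
  by apply: (is_derive_eq (is_derive1_comp (is_derive_cos _) g2)); rewrite /GRing.scale/=; ring.
have ds : is_derive t 1 (fun s => sin (Im (g s))) (Im d * cos (Im (g t))).
  by apply: (is_derive_eq (is_derive1_comp (is_derive_sin _) g2)); rewrite /GRing.scale/= mulrC.
split.
  apply: (is_derive_eq (is_deriveM de dc)).
  by rewrite cReM /cexp /= /GRing.scale/=; ring.
apply: (is_derive_eq (is_deriveM de ds)).
by rewrite cImM /cexp /= /GRing.scale/=; ring.
Qed.

Lemma cderive_eq g t d e : cderive g t d -> d = e -> cderive g t e.
Proof. by move=> ? <-. Qed.

(* Complex differentiability in the form of the chain rule along real curves. *)
Definition cdiff K z d := forall g t e, g t = z -> cderive g t e ->
  cderive (K \o g) t (d * e).

Lemma cdiff_eq K z d e : cdiff K z d -> d = e -> cdiff K z e.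
Proof. by move=> ? <-. Qed.

Lemma cdiff_cst a z : cdiff (fun=> a) z 0.
Proof. by move=> g t e _ _; rewrite mul0r; exact: cderive_cst. Qed.

Lemma cdiff_id z : cdiff id z 1.
Proof. by move=> g t e _; rewrite mul1r. Qed.

Lemma cdiffD K H z d e : cdiff K z d -> cdiff H z e ->
  cdiff (fun z => K z + H z) z (d + e).
Proof.
move=> k h g t f gz cg; rewrite mulrDl.
by apply: cderiveD; [exact: k|exact: h].
Qed.

Lemma cdiffM K H z d e : cdiff K z d -> cdiff H z e ->
  cdiff (fun z => K z * H z) z (d * H z + K z * e).
Proof.
move=> k h g t f gz cg.
apply: cderive_eq; first by apply: cderiveM; [exact: (k _ _ _ gz cg)|exact: (h _ _ _ gz cg)].
by rewrite /= gz; ring.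
Qed.

Lemma cdiffV K z d : K z != 0 -> cdiff K z d ->
  cdiff (fun z => (K z)^-1) z (- (d / K z ^+ 2)).
Proof.
move=> k0 k g t f gz cg.
apply: cderive_eq; first by apply: cderiveV; [rewrite /= gz|exact: (k _ _ _ gz cg)].
by rewrite /= gz; ring.
Qed.

Lemma cdiff_exp K z d : cdiff K z d -> cdiff (fun z => cexp (K z)) z (cexp (K z) * d).
Proof.
move=> k g t f gz cg.
apply: cderive_eq; first by apply: cderive_exp; exact: (k _ _ _ gz cg).
by rewrite /= gz; ring.
Qed.

Lemma cdiff_scale (a : C) K z d : cdiff K z d -> cdiff (fun z => a * K z) z (a * d).
Proof.
move=> k; apply: cdiff_eq; first by apply: cdiffM; [exact: cdiff_cst|exact: k].
by rewrite mul0r add0r.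
Qed.

Lemma cdiff_shift (a : C) K z d : cdiff K z d -> cdiff (fun z => a + K z) z d.
Proof.
move=> k; apply: cdiff_eq; first by apply: cdiffD; [exact: cdiff_cst|exact: k].
by rewrite add0r.
Qed.

Lemma cdiff_addr (a : C) z : cdiff (fun z => z + a) z 1.
Proof.
apply: cdiff_eq; first by apply: cdiffD; [exact: cdiff_id|exact: cdiff_cst].
by rewrite addr0.
Qed.

Lemma cdiffN K z d : cdiff K z d -> cdiff (fun z => - K z) z (- d).
Proof.
move=> k; have := @cdiff_scale (-1) K z d k; rewrite mulN1r.
by under eq_fun do rewrite mulN1r.
Qed.

Lemma cderive_horizontal (s om : R) : cderive (fun s => (s +i* om)%C) s 1.
Proof.
by split; [exact: (@is_derive_id R R^o)|exact: (@is_derive_cst R R^o R^o)].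
Qed.

Lemma cderive_vertical (s om : R) : cderive (fun om => (s +i* om)%C) om 'i%C.
Proof.
by split; [exact: (@is_derive_cst R R^o R^o)|exact: (@is_derive_id R R^o)].
Qed.

Lemma cderive_line (z d : C) t : cderive (fun s => z + s%:C%C * d) t d.
Proof.
apply: cderive_eq.
  apply: cderiveD; first exact: cderive_cst.
  apply: cderiveM; last exact: cderive_cst.
  have d1 : cderive (fun s => s%:C%C) t 1.
    by split; [exact: (@is_derive_id R R^o)|exact: (@is_derive_cst R R^o R^o)].
  exact: d1.
by rewrite mulr0 add0r addr0 mul1r.
Qed.

Lemma mvt_bound (f f' : R -> R) (B : R) :
  (forall t, 0 <= t <= 1 -> is_derive t 1 f (f' t)) ->
  (forall t, 0 <= t <= 1 -> `|f' t| <= B) -> `|f 1 - f 0| <= B.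
Proof.
move=> df bf.
have [||t t01 ->] := @MVT R f f' 0 1 ltr01.
- by move=> t /subset_itv_oo_cc; rewrite in_itv/= => /df.
- apply: derivable_within_continuous => t; rewrite in_itv/= => /df.
  by move=> h; exact: ex_derive.
by rewrite subr0 mulr1 bf//; move/subset_itv_oo_cc : t01; rewrite in_itv.
Qed.

(* A bound on the derivative over a convex half-plane is a Lipschitz bound, up
   to the factor 2 lost by applying the mean value theorem to the real and
   imaginary parts separately. *)
Lemma cdiff_lipschitz K K' (B : R) :
  (forall z, 0 <= Re z -> cdiff K z (K' z)) ->
  (forall z, 0 <= Re z -> normc (K' z) <= B) ->
  forall z d, 0 <= Re z -> 0 <= Re d -> normc (K z - K d) <= 2 * B * normc (z - d).
Proof.
move=> dK bK z d z0 d0.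
pose g t : C := d + t%:C%C * (z - d).
have g_ge0 t : 0 <= t <= 1 -> 0 <= Re (g t).
  move=> /andP[t0 t1]; rewrite /g cReD cReM cReD cReN /= mul0r subr0.
  have -> : Re d + t * (Re z - Re d) = (1 - t) * Re d + t * Re z by ring.
  by rewrite addr_ge0// mulr_ge0// subr_ge0.
have g1 : g 1 = z by rewrite /g /= mul1r addrC subrK.
have g0 : g 0 = d by rewrite /g /= mul0r addr0.
have dg t : 0 <= t <= 1 -> cderive (K \o g) t (K' (g t) * (z - d)).
  move=> t01; apply: dK => //; first exact: g_ge0.
  exact: cderive_line.
have bg t : 0 <= t <= 1 -> normc (K' (g t) * (z - d)) <= B * normc (z - d).
  by move=> t01; rewrite normcM ler_wpM2r ?normc_ge0// bK// g_ge0.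
apply: le_trans (normc_le_add _) _.
rewrite -mulrA mulr2n mulrDl !mul1r lerD//.
- rewrite cReD cReN -{1}g1 -{1}g0.
  apply: (@mvt_bound (fun t => Re (K (g t))) (fun t => Re (K' (g t) * (z - d)))).
    by move=> t /dg[].
  by move=> t /bg; apply: le_trans; exact: normr_Re_le.
- rewrite cImD cImN -{1}g1 -{1}g0.
  apply: (@mvt_bound (fun t => Im (K (g t))) (fun t => Im (K' (g t) * (z - d)))).
    by move=> t /dg[].
  by move=> t /bg; apply: le_trans; exact: normr_Im_le.
Qed.

End ComplexCalculus.

(** * Bounded functions on the closed right half-plane *)

Section BoundedHalfPlane.
Variable R : realType.
Local Notation C := R[i].
Local Notation Re := complex.Re.
Local Notation Im := complex.Im.

(** Only the existence of bounds matters for domination, so constants are hidden and propagated by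
    closure rules. *)
Definition bounded_rhp (f : C -> C) :=
  exists B : R, forall z, 0 <= Re z -> normc (f z) <= B.

Lemma bounded_rhp_ge0 f : bounded_rhp f ->
  exists2 B : R, 0 <= B & forall z, 0 <= Re z -> normc (f z) <= B.
Proof.
move=> [B fB]; exists B => //.
by apply: le_trans (fB 0 _); rewrite ?normc_ge0.
Qed.

Lemma bounded_rhp_cst (c : C) : bounded_rhp (fun=> c).
Proof. by exists (normc c). Qed.

Lemma bounded_rhpD f g : bounded_rhp f -> bounded_rhp g ->
  bounded_rhp (fun z => f z + g z).
Proof.
move=> [A fA] [B gB]; exists (A + B) => z z0.
by apply: le_trans (le_normcD _ _) _; rewrite lerD ?fA ?gB.
Qed.

Lemma bounded_rhpN f : bounded_rhp f -> bounded_rhp (fun z => - f z).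
Proof. by move=> [A fA]; exists A => z z0; rewrite normcN fA. Qed.

Lemma bounded_rhpM f g : bounded_rhp f -> bounded_rhp g ->
  bounded_rhp (fun z => f z * g z).
Proof.
move=> [A fA] [B gB]; exists (A * B) => z z0.
by rewrite normcM ler_pM ?normc_ge0 ?fA ?gB.
Qed.

Lemma bounded_rhpV f (c : R) : 0 < c ->
  (forall z, 0 <= Re z -> c <= normc (f z)) -> bounded_rhp (fun z => (f z)^-1).
Proof.
move=> c0 fc; exists c^-1 => z z0; rewrite normcV lef_pV2 ?posrE ?fc//.
exact: lt_le_trans (fc _ z0).
Qed.

Lemma normc_cexp (z : C) : normc (cexp z) = expR (Re z).
Proof.
apply/eqP; rewrite -(@eqrXn2 _ 2)// ?normc_ge0 ?expR_ge0// normcE2 /=.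
by rewrite !exprMn -mulrDr cos2Dsin2 mulr1.
Qed.

End BoundedHalfPlane.

(** * Integrals over the real line *)

Section RealLineIntegrals.
Variable R : realType.
Local Notation mu := (@lebesgue_measure R).

Lemma derive_continuous (f : R -> R) (x d : R) : is_derive x 1 f d -> {for x, continuous f}.
Proof.
by move=> h; apply/differentiable_continuous/derivable1_diffP; exact: ex_derive.
Qed.

Lemma is_derive_derivable (f : R -> R) (x d : R) : is_derive x 1 f d -> derivable f x 1.
Proof. by move=> h; exact: ex_derive. Qed.

Lemma is_derive_derive1 (f : R -> R) (x d : R) : is_derive x 1 f d -> (f^`()%classic) x = d.
Proof. by move=> h; rewrite derive1E; exact: derive_val. Qed.

Lemma dominated_cvg_Rintegral (f_ : nat -> R -> R) (f g : R -> R) :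
  (forall n, measurable_fun setT (f_ n)) -> measurable_fun setT f ->
  {ae mu, forall x, f_ ^~ x @ \oo --> f x} ->
  mu.-integrable setT (EFin \o g) -> (forall n x, `|f_ n x| <= g x) ->
  mu.-integrable setT (EFin \o f) /\
  (\int[mu]_x f_ n x)%R @[n --> \oo] --> (\int[mu]_x f x)%R.
Proof.
move=> mf_ mf cf ig fg.
have [] := @dominated_convergence _ _ _ mu setT measurableT
  (fun n => EFin \o f_ n) (EFin \o f) (EFin \o g).
- by move=> n; apply/measurable_EFinP; exact: mf_.
- by apply/measurable_EFinP; exact: mf.
- have [N [mN N0 sub]] := cf; exists N; split=> // x /= h.
  by apply: sub => /= cx; apply: h => _; apply: cvg_EFin => //; exact: nearW.
- by [].
- by apply: aeW => x n _ /=; rewrite lee_fin.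
move=> if_ _ cvgf; split=> //.
have fin := integrable_fin_num measurableT if_.
apply: fine_cvg; rewrite fineK//.
Qed.

Lemma sqrD_gt0 (l x : R) : 0 < l -> 0 < l ^+ 2 + x ^+ 2.
Proof. by move=> l0; rewrite ltr_pwDl ?exprn_gt0 ?sqr_ge0. Qed.

Lemma continuous_lorentz (l : R) : 0 < l -> continuous (fun x : R => (l ^+ 2 + x ^+ 2)^-1).
Proof.
move=> l0 x; apply: cvgV; first by rewrite gt_eqF// sqrD_gt0.
by apply: cvgD; [exact: cvg_cst|exact: exprn_continuous].
Qed.

(** Evenness reduces to the half-line, where [atan (x / l) / l] is a primitive. The extended-real
    form comes first because its finiteness is what gives integrability. *)
Lemma integral_lorentz_ereal (l : R) : 0 < l ->
  (\int[mu]_x ((l ^+ 2 + x ^+ 2)^-1)%:E = (pi / l)%:E)%E.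
Proof.
move=> l0.
have ge0 x : 0 <= (l ^+ 2 + x ^+ 2)^-1 by rewrite invr_ge0 ltW// sqrD_gt0.
rewrite ge0_symfun_integralT//; last 2 first.
- exact: continuous_lorentz.
- by move=> x /=; rewrite sqrrN.
pose F x := l^-1 * atan (l^-1 * x).
have dF (x : R) : is_derive x 1 F (l ^+ 2 + x ^+ 2)^-1.
  have d1 : is_derive x 1 (fun x => l^-1 * x) l^-1.
    apply: (is_derive_eq (is_deriveM (is_derive_cst (l^-1) x 1) (is_derive_id x 1))).
    by rewrite /GRing.scale/= mulr0 addr0 mulr1.
  have d2 := is_derive1_comp (is_derive1_atan (l^-1 * x)) d1.
  apply: (is_derive_eq (is_deriveM (is_derive_cst (l^-1) x 1) d2)).
  rewrite /GRing.scale/= mulr0 addr0.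
  field; rewrite !gt_eqF//= ?sqrD_gt0// exprVn -[1](@mulVf _ (l ^+ 2)) ?gt_eqF ?exprn_gt0//.
have -> : [set x : R | 0 <= x] = `[0, +oo[%classic by rewrite set_itvcy.
rewrite (@ge0_continuous_FTC2y _ _ F 0 (l^-1 * (pi / 2)))//.
- rewrite /F mulr0 atan0 mulr0 sube0 -EFinM; congr EFin; field.
  by rewrite gt_eqF.
- by apply: continuous_subspaceT; exact: continuous_lorentz.
- apply: cvgMl_tmp; apply: (@cvg_comp _ _ _ (fun x => l^-1 * x) atan); last exact: cvgy_atan.
  by apply: gt0_cvgMry => //; rewrite invr_gt0.
- by apply: cvg_at_right_filter; exact: (derive_continuous (dF 0)).
- by move=> x _; exact: (is_derive_derive1 (dF x)).
Qed.

Lemma integrable_lorentz (l : R) : 0 < l ->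
  mu.-integrable setT (EFin \o (fun x : R => (l ^+ 2 + x ^+ 2)^-1)).
Proof.
move=> l0; apply/integrableP; split.
  by apply/measurable_EFinP; apply: continuous_measurable_fun; exact: continuous_lorentz.
rewrite [X in (X < _)%E](_ : _ = (pi / l)%:E) ?ltry// -integral_lorentz_ereal//.
by apply: eq_integral => x _ /=; rewrite ger0_norm// invr_ge0 ltW// sqrD_gt0.
Qed.

Lemma Rintegral_lorentz (l : R) : 0 < l ->
  (\int[mu]_x (l ^+ 2 + x ^+ 2)^-1)%R = pi / l.
Proof. by move=> l0; rewrite /Rintegral integral_lorentz_ereal. Qed.

Lemma integrableT_of_le (f : R -> R) (A : R) : measurable_fun setT f ->
  (forall x, `|f x| <= A * (1 + x ^+ 2)^-1) -> mu.-integrable setT (EFin \o f).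
Proof.
move=> mf fA.
have ig : mu.-integrable setT (EFin \o (fun x : R => A * (1 + x ^+ 2)^-1)).
  have := integrableZl measurableT A (integrable_lorentz (@ltr01 R)).
  rewrite expr1n; by apply: eq_integrable.
apply: le_integrable ig => //; first exact/measurable_EFinP.
move=> x _ /=; rewrite lee_fin; apply: le_trans (fA x) (ler_norm _).
Qed.

Lemma cvg_lorentz_nat (A : R) : A * (1 + (n.+1%:R : R) ^+ 2)^-1 @[n --> \oo] --> (0 : R).
Proof.
rewrite -[0 in X in _ --> X](mulr0 A); apply: cvgMl_tmp.
apply: (@squeeze_cvgr _ _ _ _ (cst 0) (@harmonic R)); last 2 first.
- exact: cvg_cst.
- exact: cvg_harmonic.
near=> n; have d0 : 0 < 1 + (n.+1%:R : R) ^+ 2 by rewrite ltr_pwDl ?sqr_ge0.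
rewrite /= invr_ge0 (ltW d0)/= /harmonic lef_pV2 ?posrE//.
rewrite (@le_trans _ _ (n.+1%:R ^+ 2))// ?lerDr// expr2 ler_peMr// ler1n//.
Unshelve. all: by end_near. Qed.

(** On growing symmetric intervals the integral is a difference of boundary values of [g], which
    decay; the decay of [g'] dominates the truncations. *)
Lemma Rintegral_derive0 (g g' : R -> R) (A A' : R) :
  (forall x : R, is_derive x 1 g (g' x)) -> continuous g' ->
  (forall x, `|g x| <= A * (1 + x ^+ 2)^-1) ->
  (forall x, `|g' x| <= A' * (1 + x ^+ 2)^-1) ->
  (\int[mu]_x g' x)%R = 0.
Proof.
move=> dg cg' gA g'A.
(* The successor keeps the interval nondegenerate for [n = 0], as the fundamental theorem
   requires. *)
pose D (n : nat) : set R := `[- n.+1%:R, n.+1%:R]%classic.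
have mg' : measurable_fun setT g' by exact: continuous_measurable_fun.
have mD n : measurable (D n) by exact: measurable_itv.
have [|||||] := @dominated_cvg_Rintegral (fun n => g' \_ (D n)) g' (fun x => A' * (1 + x ^+ 2)^-1).
- move=> n; apply/(measurable_restrictT _ (mD n)); exact: measurable_funTS.
- by [].
- apply: aeW => x; apply: cvg_near_cst.
  exists (Num.bound `|x|) => // n /= xn; rewrite patchE mem_set//.
  rewrite /D /= in_itv/= -ler_norml; apply: le_trans (ltW (archi_boundP (normr_ge0 x))) _.
  by rewrite ler_nat (leq_trans xn).
- apply: (@integrableT_of_le _ `|A'|).
    apply: continuous_measurable_fun => x; apply: cvgMl_tmp.
    by have := @continuous_lorentz 1 ltr01 x; rewrite expr1n.
  by move=> x; rewrite normrM [X in _ * X]ger0_norm// invr_ge0 addr_ge0// sqr_ge0.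
- move=> n x; rewrite patchE; case: ifP => // _; rewrite normr0.
  exact: le_trans (g'A x).
move=> _ cvg1.
suff cvg0 : (\int[mu]_x (g' \_ (D n)) x)%R @[n --> \oo] --> (0 : R).
  exact: (cvg_unique _ cvg1 cvg0).
have -> : (fun n => (\int[mu]_x (g' \_ (D n)) x)%R) = (fun n : nat => g n.+1%:R - g (- n.+1%:R)).
  apply/funext => n; rewrite -Rintegral_mkcond /Rintegral.
  rewrite (@continuous_FTC2 _ g' g)//.
  - by rewrite gtrN.
  - exact: continuous_subspaceT.
  - split.
    + by move=> x _; exact: (is_derive_derivable (dg x)).
    + by apply: cvg_at_right_filter; exact: (derive_continuous (dg _)).
    + by apply: cvg_at_left_filter; exact: (derive_continuous (dg _)).
  - by move=> x _; exact: (is_derive_derive1 (dg x)).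
rewrite -[0 in X in _ --> X](subr0 0).
apply: cvgB; apply: norm_cvg0; apply: (@squeeze_cvgr _ _ _ _ (cst 0)) (cvg_lorentz_nat A).
- by near=> n; rewrite /= normr_ge0 gA.
- exact: cvg_cst.
- by near=> n; rewrite /= normr_ge0 -[n.+1%:R]opprK sqrrN opprK gA.
- exact: cvg_cst.
Unshelve. all: by end_near. Qed.

End RealLineIntegrals.

(** * The delay integral *)

Section DelayKernel.
Variables (R : realType) (lam tau : R).
Local Notation C := R[i].
Local Notation Re := complex.Re.
Local Notation Im := complex.Im.
Hypotheses (lam_gt0 : 0 < lam) (tau_ge0 : 0 <= tau) (taulam : tau * lam < pi / 2).

Local Notation x := (tau * lam).
Definition delay_gain : R := cos x / (1 - sin x).
Definition edelay (z : C) : C := cexp ((- tau)%:C%C * z).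
Definition delay_char (z : C) : C := z + lam%:C%C * edelay z.
Definition delay_char' (z : C) : C := 1 + lam%:C%C * (edelay z * (- tau)%:C%C).
Definition ilam : C := (0 +i* lam)%C.

(* [(lam e^(-tau z) - z) / (lam e^(-tau z) + z) + gain * (z - lam) / (z + lam)] *)
Definition knum (z : C) : C :=
  (- 1 + (2 * lam)%:C%C * (edelay z * (delay_char z)^-1)) +
  delay_gain%:C%C * (1 + (- (2 * lam))%:C%C * (z + lam%:C%C)^-1).
Definition knum' (z : C) : C :=
  (2 * lam)%:C%C * (edelay z * (- tau)%:C%C * (delay_char z)^-1 +
                    edelay z * (- (delay_char' z / delay_char z ^+ 2))) +
  delay_gain%:C%C * ((- (2 * lam))%:C%C * (- (1 / (z + lam%:C%C) ^+ 2))).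

(** [z^2 + lam^2] is kept factored so that the two singular points can be estimated separately. At
    either point the value is [0] by the convention on inverses, not the removable limit. *)
Definition kern (z : C) : C := knum z * ((z - ilam)^-1 * (z + ilam)^-1).
Definition kern' (z : C) : C :=
  knum' z * ((z - ilam)^-1 * (z + ilam)^-1) -
  knum z * (((z - ilam)^-1 + (z + ilam)^-1) * ((z - ilam)^-1 * (z + ilam)^-1)).

Let x_ge0 : 0 <= x. Proof. by rewrite mulr_ge0// ltW. Qed.

Lemma sin_delay_lt1 : sin x < 1.
Proof.
have p0 := pi_gt0 R; rewrite -(sin_pihalf R) ltr_sin// in_itv/=.
- by apply/andP; split; move: x_ge0 taulam; lra.
- by rewrite lexx andbT; lra.
Qed.

Lemma cos_delay_gt0 : 0 < cos x.
Proof.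
apply: cos_gt0_pihalf; rewrite taulam andbT.
by apply: lt_le_trans x_ge0; rewrite oppr_lt0 divr_gt0// pi_gt0.
Qed.

Let sin1 : 1 - sin x != 0.
Proof. by rewrite gt_eqF// subr_gt0 sin_delay_lt1. Qed.

Lemma normc_edelay z : 0 <= Re z -> normc (edelay z) <= 1.
Proof.
move=> z0; rewrite /edelay normc_cexp cReM /= mul0r subr0.
by rewrite -expR0 ler_expR mulNr oppr_le0 mulr_ge0.
Qed.

Lemma bounded_edelay : bounded_rhp edelay.
Proof. by exists 1 => z; exact: normc_edelay. Qed.

(* A root [z] would have [|z| <= lam], hence [|Im (tau z)| < pi / 2] and
   [Re (delay_char z) > 0]; the width [lam (1 + dl)] leaves a uniform margin. *)
Lemma delay_char_lower : exists2 c : R, 0 < c &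
  forall z, 0 <= Re z -> c <= normc (delay_char z).
Proof.
(* Chosen so that [x * dl] is at most half the gap [pi / 2 - x]; the [x + 1] keeps the quotient
   meaningful when [x = 0]. *)
pose dl := (pi / 2 - x) / (2 * (x + 1)).
have dl0 : 0 < dl by rewrite divr_gt0// ?subr_gt0// mulr_gt0// ltr_pwDr.
pose y := x * (1 + dl).
have y0 : 0 <= y by rewrite mulr_ge0// addr_ge0// ltW.
have ylt : y < pi / 2.
  have : x * dl <= (pi / 2 - x) / 2.
    have -> : (pi / 2 - x) / 2 = (x + 1) * dl :> R.
      rewrite /dl; field.
      by rewrite gt_eqF// ltr_pwDr.
    by rewrite ler_pM2r// lerDl.
  rewrite /y; move: taulam; lra.
have cy : 0 < cos y.
  apply: cos_gt0_pihalf; rewrite ylt andbT.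
  by apply: lt_le_trans y0; rewrite oppr_lt0 divr_gt0// pi_gt0.
have ex0 : 0 < expR (- tau) := expR_gt0 _.
(* One bound per region. In the strip [|Im z| <= lam (1 + dl)] the real part is at least [Re z] when
   [Re z > 1], and at least [lam e^(-tau) cos y] otherwise. Outside the strip [|Im z|] exceeds the
   modulus of the delay term by [lam * dl]. *)
pose c := Num.min (Num.min 1 (lam * (expR (- tau) * cos y))) (lam * dl).
have c0 : 0 < c.
  rewrite /c !lt_min ltr01 /=; apply/andP; split; first by rewrite !mulr_gt0.
  by rewrite mulr_gt0.
exists c => // z z0.
have [zl|zl] := lerP `|Im z| (lam * (1 + dl)).
  apply: le_trans (normr_Re_le _).
  apply: le_trans (ler_norm _).
  rewrite /c ge_min; apply/orP; left.
  rewrite /delay_char cReD cReM /= mul0r subr0 cReM cImM /= !mul0r subr0 addr0.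
  have cosy : cos y <= cos (- tau * Im z).
    have -> : cos (- tau * Im z) = cos (tau * `|Im z|).
      by rewrite mulNr cosN; case: ger0P => // _; rewrite mulrN cosN.
    have ty : tau * `|Im z| <= y.
      by rewrite /y -mulrA ler_wpM2l.
    rewrite le_eqVlt in ty; case/orP: ty => [/eqP ->//|ty].
    apply/ltW; rewrite ltr_cos// in_itv/=.
    - have p0 := pi_gt0 R; rewrite mulr_ge0//=.
      by apply: le_trans (ltW ty) _; move: ylt; lra.
    - by have p0 := pi_gt0 R; rewrite y0/=; move: ylt; lra.
  have cp : 0 < cos (- tau * Im z) := lt_le_trans cy cosy.
  have [z1|z1] := lerP (Re z) 1.
    rewrite ge_min; apply/orP; right.
    rewrite -[leLHS]add0r lerD// ler_pM2l//.
    apply: ler_pM => //; first exact: ltW cy.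
    by rewrite ler_expR mulNr lerN2 ler_piMr.
  rewrite ge_min; apply/orP; left.
  rewrite -[leLHS]addr0 lerD//; first exact: ltW.
  by rewrite mulr_ge0 ?ltW// mulr_gt0 ?expR_gt0.
rewrite /c ge_min; apply/orP; right.
rewrite /delay_char; apply: le_trans (normcB_ge _ _).
rewrite normcM normcR (gtr0_norm lam_gt0) lerBrDr.
apply: (@le_trans _ _ `|Im z|); last exact: normr_Im_le.
apply: le_trans (ltW zl).
rewrite mulrDr mulr1 addrC lerD2r.
by rewrite ler_piMr ?(ltW lam_gt0)// normc_edelay.
Qed.

Lemma delay_char_neq0 z : 0 <= Re z -> delay_char z != 0.
Proof.
move=> z0; have [c c0 /(_ z z0)] := delay_char_lower.
apply: contraTneq => ->; rewrite -ltNge.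
by rewrite normc0.
Qed.

Lemma addlam_lower z : 0 <= Re z -> lam <= normc (z + lam%:C%C).
Proof.
move=> z0; apply: le_trans (normr_Re_le _); apply: le_trans (ler_norm _).
by rewrite cReD /= lerDr.
Qed.

Lemma addlam_neq0 z : 0 <= Re z -> z + lam%:C%C != 0.
Proof.
move=> /addlam_lower; apply: contraTneq => ->.
by rewrite normc0 -ltNge.
Qed.

Lemma cdiff_edelay z : cdiff edelay z (edelay z * (- tau)%:C%C).
Proof.
apply: cdiff_exp; apply: cdiff_eq; first by apply: cdiffM; [exact: cdiff_cst|exact: cdiff_id].
by rewrite mul0r add0r mulr1.
Qed.

Lemma cdiff_delay_char z : cdiff delay_char z (delay_char' z).
Proof.
apply: cdiffD; first exact: cdiff_id.
apply: cdiff_eq; first by apply: cdiffM; [exact: cdiff_cst|exact: cdiff_edelay].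
by rewrite mul0r add0r.
Qed.

Lemma cdiff_knum z : 0 <= Re z -> cdiff knum z (knum' z).
Proof.
move=> z0; apply: cdiffD.
  apply: cdiff_shift; apply: cdiff_scale.
  apply: cdiffM; first exact: cdiff_edelay.
  by apply: cdiffV; [exact: delay_char_neq0|exact: cdiff_delay_char].
apply: cdiff_scale; apply: cdiff_shift; apply: cdiff_scale.
by apply: (@cdiffV _ (fun z => z + lam%:C%C)); [exact: addlam_neq0|exact: cdiff_addr].
Qed.

Lemma bounded_delay_charV : bounded_rhp (fun z => (delay_char z)^-1).
Proof. by have [c c0 h] := delay_char_lower; exact: bounded_rhpV h. Qed.

Lemma bounded_addlamV : bounded_rhp (fun z => (z + lam%:C%C)^-1).
Proof. exact: bounded_rhpV lam_gt0 addlam_lower. Qed.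

(** This is why [knum] is written with constants split off: every remaining factor is bounded,
    whereas the numerator of [(lam e^(-tau z) - z) / p z] grows with [z]. *)
Lemma bounded_knum : bounded_rhp knum.
Proof.
apply: bounded_rhpD.
  apply: bounded_rhpD; first exact: bounded_rhp_cst.
  apply: bounded_rhpM; first exact: bounded_rhp_cst.
  exact: (bounded_rhpM bounded_edelay bounded_delay_charV).
apply: bounded_rhpM; first exact: bounded_rhp_cst.
apply: bounded_rhpD; first exact: bounded_rhp_cst.
exact: (bounded_rhpM (bounded_rhp_cst _) bounded_addlamV).
Qed.

Lemma bounded_knum' : bounded_rhp knum'.
Proof.
have bp' : bounded_rhp delay_char'.
  apply: bounded_rhpD; first exact: bounded_rhp_cst.
  apply: bounded_rhpM; first exact: bounded_rhp_cst.
  exact: (bounded_rhpM bounded_edelay (bounded_rhp_cst _)).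
have bsq f : bounded_rhp (fun z => (f z)^-1) -> bounded_rhp (fun z => (f z ^+ 2)^-1).
  by move=> bf; under eq_fun do rewrite expr2 invfM; exact: bounded_rhpM.
apply: bounded_rhpD; apply: bounded_rhpM; do ?exact: bounded_rhp_cst.
  apply: bounded_rhpD.
    apply: bounded_rhpM bounded_delay_charV.
    exact: (bounded_rhpM bounded_edelay (bounded_rhp_cst _)).
  apply: bounded_rhpM; first exact: bounded_edelay.
  apply: bounded_rhpN; apply: bounded_rhpM; first exact: bp'.
  exact: (bsq _ delay_char bounded_delay_charV).
apply: bounded_rhpM; first exact: bounded_rhp_cst.
apply: bounded_rhpN; apply: bounded_rhpM; first exact: bounded_rhp_cst.
exact: (bsq _ _ bounded_addlamV).
Qed.

(** With [gain2], the real and imaginary parts of the cancellation at [ilam]; the two are compatible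
    because [cos^2 = (1 - sin) (1 + sin)]. *)
Let gain1 : cos x = delay_gain * (1 - sin x).
Proof. by rewrite /delay_gain divfK. Qed.

Let gain2 : 1 + sin x = delay_gain * cos x.
Proof.
apply: (mulIf sin1).
transitivity (cos x * (delay_gain * (1 - sin x))); last by ring.
by rewrite -gain1 -expr2 cos2sin2; ring.
Qed.

(** At [ilam] the delay quotient equals [- i g] with [g = delay_gain], and [(z - lam) / (z + lam)]
    equals [i], so weighting the latter by [g] cancels the sum. *)
Lemma knum_ilam : knum ilam = 0.
Proof.
have Re_ilam : 0 <= Re ilam by [].
have p0 := delay_char_neq0 Re_ilam.
have m0 := addlam_neq0 Re_ilam.
have h1 : lam%:C%C * edelay ilam - ilam = - (delay_gain%:C%C * 'i%C) * delay_char ilam.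
  rewrite /delay_char /edelay /cexp /ilam.
  apply: complex_eq; rewrite ?cReD ?cImD ?cReN ?cImN ?cReM ?cImM /=.
    rewrite !(mul0r, mulr0, add0r, addr0, subr0, oppr0, expR0, mul1r, mulr1) mulNr cosN sinN.
    by rewrite {1}gain1; ring.
  rewrite !(mul0r, mulr0, add0r, addr0, subr0, oppr0, expR0, mul1r, mulr1) mulNr cosN sinN.
  have := gain2 => /(congr1 (fun y => - lam * y)) h.
  by apply: etrans (etrans _ h) _; ring.
have h2 : ilam - lam%:C%C = 'i%C * (ilam + lam%:C%C).
  by apply: complex_eq; rewrite ?cReD ?cImD ?cReN ?cImN ?cReM ?cImM /=; ring.
have -> : knum ilam = (lam%:C%C * edelay ilam - ilam) / delay_char ilam +
    delay_gain%:C%C * ((ilam - lam%:C%C) / (ilam + lam%:C%C)).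
  have -> : lam%:C%C * edelay ilam - ilam = (2 * lam)%:C%C * edelay ilam - delay_char ilam.
    by rewrite /delay_char rmorphM /=; ring.
  have -> : ilam - lam%:C%C = ilam + lam%:C%C + (- (2 * lam))%:C%C.
    by rewrite rmorphN rmorphM /=; ring.
  by rewrite mulrBl divff// (mulrDl (_ + _)) divff// /knum; ring.
by rewrite h1 h2 !mulfK//; ring.
Qed.

(** The conjugate cancellation: the quotients are now [i g] and [- i]. *)
Lemma knum_Nilam : knum (- ilam) = 0.
Proof.
have Re_ilam : 0 <= Re (- ilam) by rewrite /= oppr0.
have p0 := delay_char_neq0 Re_ilam.
have m0 := addlam_neq0 Re_ilam.
have h1 : lam%:C%C * edelay (- ilam) - (- ilam) = delay_gain%:C%C * 'i%C * delay_char (- ilam).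
  rewrite /delay_char /edelay /cexp /ilam.
  apply: complex_eq; rewrite ?cReD ?cImD ?cReN ?cImN ?cReM ?cImM /=.
    rewrite !(mul0r, mulr0, add0r, addr0, subr0, oppr0, expR0, mul1r, mulr1, mulrNN, opprK).
    by rewrite {1}gain1; ring.
  rewrite !(mul0r, mulr0, add0r, addr0, subr0, oppr0, expR0, mul1r, mulr1, mulrNN, opprK).
  have := gain2 => /(congr1 (fun y => lam * y)) h.
  by apply: etrans (etrans _ h) _; ring.
have h2 : - ilam - lam%:C%C = - 'i%C * (- ilam + lam%:C%C).
  by apply: complex_eq; rewrite ?cReD ?cImD ?cReN ?cImN ?cReM ?cImM /=; ring.
have -> : knum (- ilam) = (lam%:C%C * edelay (- ilam) - (- ilam)) / delay_char (- ilam) +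
    delay_gain%:C%C * ((- ilam - lam%:C%C) / (- ilam + lam%:C%C)).
  have -> : lam%:C%C * edelay (- ilam) - (- ilam) = (2 * lam)%:C%C * edelay (- ilam) - delay_char (- ilam).
    by rewrite /delay_char rmorphM /=; ring.
  have -> : - ilam - lam%:C%C = - ilam + lam%:C%C + (- (2 * lam))%:C%C.
    by rewrite rmorphN rmorphM /=; ring.
  by rewrite mulrBl divff// (mulrDl (_ + _)) divff// /knum; ring.
by rewrite h1 h2 !mulfK//; ring.
Qed.

Lemma cdiff_kern z : 0 <= Re z -> z - ilam != 0 -> z + ilam != 0 ->
  cdiff kern z (kern' z).
Proof.
move=> z0 zl zNl; apply: cdiff_eq.
  apply: cdiffM; first exact: cdiff_knum.
  apply: cdiffM; apply: cdiffV => //; exact: cdiff_addr.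
by rewrite /kern' !expr2 !div1r !invfM; ring.
Qed.

(** Since [knum] vanishes at [+- ilam] and is Lipschitz, it is at most [2 * B1] times the distance
    to either point, which tames the singularities up to the axis. Far out, each factor [z +- ilam]
    has modulus at least [|Im z| / 2]. *)
Lemma normc_kern_le (B0 B1 : R) :
  (forall z, 0 <= Re z -> normc (knum z) <= B0) ->
  (forall z, 0 <= Re z -> normc (knum' z) <= B1) ->
  forall z, 0 <= Re z -> z - ilam != 0 -> z + ilam != 0 ->
  normc (kern z) <= 2 * B1 / lam /\ (2 * lam <= `|Im z| -> normc (kern z) <= B0 * (4 / Im z ^+ 2)).
Proof.
move=> b0 b1 z z0 zl zNl.
have u0 : 0 < normc (z - ilam) by exact: normc_gt0.
have v0 : 0 < normc (z + ilam) by exact: normc_gt0.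
have Bu : normc (knum z) <= 2 * B1 * normc (z - ilam).
  rewrite -[knum z]subr0 -knum_ilam.
  exact: (cdiff_lipschitz cdiff_knum b1).
have Bv : normc (knum z) <= 2 * B1 * normc (z + ilam).
  have := @cdiff_lipschitz _ knum knum' B1 cdiff_knum b1 z (- ilam) z0.
  by rewrite knum_Nilam subr0 opprK; apply; rewrite /= oppr0.
have uv : 2 * lam <= normc (z - ilam) + normc (z + ilam).
  have -> : 2 * lam = normc (2 * ilam).
    rewrite normcM [normc ilam]/= expr0n add0r sqrtr_sqr gtr0_norm//.
    rewrite [normc 2](_ : _ = normc (2%:C)%C); last by congr normc; rewrite rmorph_nat.
    by rewrite normcR ger0_norm.
  have -> : 2 * ilam = - (z - ilam) + (z + ilam) by ring.
  by apply: le_trans (le_normcD _ _) _; rewrite normcN.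
rewrite /kern !normcM !normcV; split.
  (* With [u], [v] the two distances, [1 / (u v) = (1 / u + 1 / v) / (u + v)] uses only one
     Lipschitz bound at a time, and [u + v >= 2 lam] because the points are [2 lam] apart. *)
  have -> : normc (knum z) * ((normc (z - ilam))^-1 * (normc (z + ilam))^-1) =
    (normc (knum z) / normc (z - ilam) + normc (knum z) / normc (z + ilam)) /
    (normc (z - ilam) + normc (z + ilam)).
    field.
    by rewrite !gt_eqF ?addr_gt0.
  rewrite ler_pdivrMr ?addr_gt0//.
  have B10 : 0 <= B1 by apply: le_trans (b1 _ z0); exact: normc_ge0.
  apply: (@le_trans _ _ (2 * B1 / lam * (2 * lam))).
    have -> : 2 * B1 / lam * (2 * lam) = 2 * B1 + 2 * B1 by field; rewrite gt_eqF.
    by rewrite lerD// ler_pdivrMr.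
  by apply: ler_wpM2l => //; rewrite divr_ge0 ?mulr_ge0 ?(ltW lam_gt0).
move=> lIm.
have w0 : 0 < Im z ^+ 2.
  by rewrite exprn_even_gt0//= -normr_gt0 (lt_le_trans _ lIm)// mulr_gt0.
have half d : `|Im d| <= lam -> `|Im z| / 2 <= normc (z + d).
  move=> dl; apply: le_trans (normr_Im_le _); rewrite cImD.
  have := lerB_normD (Im z) (Im d); move: dl lIm lam_gt0; lra.
rewrite ler_pM ?normc_ge0 ?b0// ?mulr_ge0 ?invr_ge0 ?normc_ge0//.
have -> : 4 / Im z ^+ 2 = (`|Im z| / 2)^-1 * (`|Im z| / 2)^-1.
  rewrite -invfM -expr2 exprMn real_normK ?num_real//; field.
  by move: w0; rewrite exprn_even_gt0.
have i0 : 0 < `|Im z| / 2.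
  by rewrite divr_gt0// (lt_le_trans _ lIm)// mulr_gt0.
by rewrite ler_pM ?invr_ge0 ?normc_ge0// lef_pV2 ?posrE// half//= ?normrN gtr0_norm.
Qed.

(** The bound depends on [Im z] only, so a single integrable function dominates [kern] on all
    vertical lines, both towards infinity and towards the axis. *)
Lemma kern_bound : exists2 A : R, 0 <= A & forall z, 0 <= Re z ->
  z - ilam != 0 -> z + ilam != 0 -> normc (kern z) <= A * (1 + Im z ^+ 2)^-1.
Proof.
have [B0 B00 b0] := bounded_rhp_ge0 bounded_knum.
have [B1 B10 b1] := bounded_rhp_ge0 bounded_knum'.
(* [A1] serves [|Im z| <= 2 lam], where [1 + Im z ^+ 2] is at most its value at [2 lam]; [A2] serves
   the rest, where [(1 + Im z ^+ 2) / Im z ^+ 2] is largest at [2 lam]. *)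
pose A1 := 2 * B1 / lam * (1 + (2 * lam) ^+ 2).
pose A2 := B0 * 4 * ((2 * lam) ^- 2 + 1).
have l20 : 0 < (2 * lam) ^+ 2 by rewrite exprn_gt0// mulr_gt0.
have A10 : 0 <= A1.
  rewrite /A1 mulr_ge0//; first by rewrite divr_ge0 ?mulr_ge0 ?(ltW lam_gt0).
  by rewrite addr_ge0// ltW.
have A20 : 0 <= A2 by rewrite /A2 !mulr_ge0// addr_ge0// invr_ge0 ltW.
exists (A1 + A2); first by rewrite addr_ge0.
move=> z z0 zl zNl.
have [h1 h2] := normc_kern_le b0 b1 z0 zl zNl.
have d0 : 0 < 1 + Im z ^+ 2 by rewrite ltr_pwDl// sqr_ge0.
rewrite ler_pdivlMr//.
have [lIm|/ltW Iml] := leP (2 * lam) `|Im z|.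
  apply: (@le_trans _ _ A2); last by rewrite lerDr.
  apply: le_trans (ler_wpM2r (ltW d0) (h2 lIm)) _.
  have w1 : (2 * lam) ^+ 2 <= Im z ^+ 2.
    by rewrite -[leRHS]real_normK ?num_real// ler_pXn2r// nnegrE// mulr_ge0// ltW.
  have w0 := lt_le_trans l20 w1.
  rewrite /A2 -!mulrA ler_wpM2l// ler_pM2l// mulrDr mulr1 mulVf ?gt_eqF//.
  by rewrite lerD2r lef_pV2 ?posrE.
apply: (@le_trans _ _ A1); last by rewrite lerDl.
apply: le_trans (ler_wpM2r (ltW d0) h1) _.
rewrite /A1 ler_wpM2l// ?divr_ge0 ?mulr_ge0 ?(ltW lam_gt0)// lerD2l.
by rewrite -[leLHS]real_normK ?num_real// ler_pXn2r// nnegrE// mulr_ge0// ltW.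
Qed.

(** Here [+- ilam] stay at distance at least [a], so the denominators alone give the decay. The
    constant depends on [a]; the derivative is accordingly only integrated along lines off the
    axis. *)
Lemma kern'_bound (a : R) : 0 < a -> exists2 A : R, 0 <= A & forall z, a <= Re z ->
  normc (kern' z) <= A * (1 + Im z ^+ 2)^-1.
Proof.
move=> a0.
have [B0 B00 b0] := bounded_rhp_ge0 bounded_knum.
have [B1 B10 b1] := bounded_rhp_ge0 bounded_knum'.
have a20 : 0 < a ^+ 2 by rewrite exprn_gt0.
(* From [Im z ^+ 2 <= 2 (Im z +- lam)^2 + 2 lam^2]: the constant part [1 + 2 lam^2] is absorbed
   using [|z +- ilam| >= a], and the rest costs the factor [2]. *)
pose kap := (1 + 2 * lam ^+ 2) / a ^+ 2 + 2.
have kap0 : 0 <= kap by rewrite addr_ge0// divr_ge0 ?(ltW a20)// addr_ge0// mulr_ge0// sqr_ge0.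
exists ((B1 + B0 * (a^-1 + a^-1)) * kap).
  by rewrite mulr_ge0// addr_ge0// mulr_ge0// addr_ge0// invr_ge0 ltW.
move=> z az.
have z0 : 0 <= Re z by rewrite (le_trans (ltW a0)).
have d0 : 0 < 1 + Im z ^+ 2 by rewrite ltr_pwDl// sqr_ge0.
have low d : Re d = 0 -> a <= normc (z + d).
  move=> d1; apply: le_trans (normr_Re_le _); apply: le_trans (ler_norm _).
  by rewrite cReD d1 addr0.
have low2 d : Re d = 0 -> Im d ^+ 2 = lam ^+ 2 ->
    1 + Im z ^+ 2 <= kap * normc (z + d) ^+ 2.
  move=> d1 d2; rewrite normcE2 cReD cImD d1 addr0.
  have az2 : a ^+ 2 <= Re z ^+ 2 by rewrite ler_pXn2r// nnegrE ltW.
  apply: (@le_trans _ _ ((1 + 2 * lam ^+ 2) + 2 * (Im z + Im d) ^+ 2)).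
    have := sqr_ge0 (Im z + Im d + Im d); rewrite -d2; nra.
  rewrite /kap [leRHS]mulrDl lerD//.
    rewrite -mulrA; apply: ler_peMr; first by rewrite addr_ge0// mulr_ge0// sqr_ge0.
    by rewrite ler_pdivlMl// mulr1 (le_trans az2)// lerDl sqr_ge0.
  by rewrite ler_pM2l// lerDr sqr_ge0.
have l1 : a <= normc (z - ilam) by apply: low; rewrite /= oppr0.
have l2 : a <= normc (z + ilam) by exact: low.
have m1 : 1 + Im z ^+ 2 <= kap * normc (z - ilam) ^+ 2.
  by apply: low2; rewrite /= ?oppr0// sqrrN.
have m2 : 1 + Im z ^+ 2 <= kap * normc (z + ilam) ^+ 2 by exact: low2.
have u0 := lt_le_trans a0 l1.
have v0 := lt_le_trans a0 l2.
have uv : normc ((z - ilam)^-1 * (z + ilam)^-1) <= kap * (1 + Im z ^+ 2)^-1.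
  rewrite normcM !normcV -invfM ler_pdivlMr// ler_pdivrMl ?mulr_gt0//.
  rewrite -(@ler_pXn2r _ 2)// ?nnegrE ?(ltW d0)// ?mulr_ge0 ?(ltW u0) ?(ltW v0)//.
  have -> : (normc (z - ilam) * normc (z + ilam) * kap) ^+ 2 =
    (kap * normc (z - ilam) ^+ 2) * (kap * normc (z + ilam) ^+ 2) by ring.
  by rewrite expr2 ler_pM// ltW.
have su : normc ((z - ilam)^-1 + (z + ilam)^-1) <= a^-1 + a^-1.
  apply: le_trans (le_normcD _ _) _.
  by rewrite !normcV lerD// lef_pV2 ?posrE.
rewrite /kern' [knum z * (_ * _)]mulrA -mulrBl normcM -mulrA ler_pM ?normc_ge0//.
apply: le_trans (le_normcD _ _) _; rewrite normcN normcM.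
by rewrite lerD ?b1// ler_pM ?normc_ge0 ?b0.
Qed.

Lemma edelay_axis (om : R) :
  edelay (0 +i* om)%C = (cos (tau * om) +i* - sin (tau * om))%C.
Proof.
rewrite /edelay /cexp; apply: complex_eq => /=.
  by rewrite !(mul0r, mulr0, subr0, add0r, addr0, oppr0) expR0 mul1r mulNr cosN.
by rewrite !(mul0r, mulr0, subr0, add0r, addr0, oppr0) expR0 mul1r mulNr sinN.
Qed.

Lemma delay_char_axis (om : R) : delay_char (0 +i* om)%C =
  ((lam * cos (tau * om)) +i* (om - lam * sin (tau * om)))%C.
Proof. by rewrite /delay_char edelay_axis; apply: complex_eq => /=; ring. Qed.

Lemma Re_kern_axis (om : R) : om ^+ 2 != lam ^+ 2 ->
  Re (kern (0 +i* om)%C) =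
  ((lam * cos (tau * om)) ^+ 2 + (om - lam * sin (tau * om)) ^+ 2)^-1
  - delay_gain / (lam ^+ 2 + om ^+ 2).
Proof.
move=> oml.
set z := (0 +i* om)%C; set c := cos (tau * om); set s := sin (tau * om).
have Re_z : 0 <= Re z by [].
have p0 := delay_char_neq0 Re_z.
have m0 := addlam_neq0 Re_z.
have cs : c ^+ 2 + s ^+ 2 = 1 by exact: cos2Dsin2.
have ez : edelay z = (c +i* - s)%C := edelay_axis om.
have pz : delay_char z = ((lam * c) +i* (om - lam * s))%C := delay_char_axis om.
(* On the axis this factor is real and leaves the real part. *)
have uv : (z - ilam)^-1 * (z + ilam)^-1 = ((lam ^+ 2 - om ^+ 2)^-1)%:C%C.
  rewrite -invfM fmorphV; congr (_^-1).
  by rewrite /z /ilam; apply: complex_eq => /=; ring.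
have d0 : (lam * c) ^+ 2 + (om - lam * s) ^+ 2 != 0.
  by move: (normc_gt0 p0); rewrite pz /= sqrtr_gt0 => /gt_eqF ->.
have l0 : 0 < lam ^+ 2 + om ^+ 2 by rewrite ltr_pwDl ?exprn_gt0 ?sqr_ge0.
have ol : lam ^+ 2 - om ^+ 2 != 0 by rewrite subr_eq0 eq_sym.
rewrite /kern uv cReMr.
rewrite /knum ez pz /z.
rewrite !(cReD, cImD, cReM, cImM, cReV, cImV) /= !(mul0r, mulr0, addr0, add0r, subr0, oppr0).
have -> : - 1 + 2 * lam * (c * (lam * c * ((lam * c) ^+ 2 + (om - lam * s) ^+ 2)^-1) -
   - s * - ((om - lam * s) * ((lam * c) ^+ 2 + (om - lam * s) ^+ 2)^-1)) =
   (lam ^+ 2 - om ^+ 2) / ((lam * c) ^+ 2 + (om - lam * s) ^+ 2).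
  apply: (mulIf d0); rewrite divfK// mulrDl.
  transitivity (lam ^+ 2 * (c ^+ 2 + s ^+ 2) - om ^+ 2); last by rewrite cs; ring.
  by field.
by field; rewrite gt_eqF//= ol d0.
Qed.

Local Notation mu := (@lebesgue_measure R).

Let rhp_neq (s om : R) : 0 < s -> (s +i* om)%C - ilam != 0 /\ (s +i* om)%C + ilam != 0.
Proof.
by move=> s0; rewrite !eq_complex /= oppr0 !addr0 gt_eqF.
Qed.

Let axis_neq (om : R) : om ^+ 2 != lam ^+ 2 ->
  (0 +i* om)%C - ilam != 0 /\ (0 +i* om)%C + ilam != 0.
Proof.
rewrite eqf_sqr negb_or => /andP[h1 h2].
by rewrite !eq_complex /= oppr0 !addr0 eqxx/= subr_eq0 addr_eq0.
Qed.

Lemma is_derive_Re_kern (s om : R) : 0 < s ->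
  is_derive s 1 (fun s => Re (kern (s +i* om)%C)) (Re (kern' (s +i* om)%C)).
Proof.
move=> s0; have [n1 n2] := rhp_neq om s0.
have dk := cdiff_kern (ltW s0 : 0 <= Re (s +i* om)%C) n1 n2.
have [+ _] := dk (fun s => (s +i* om)%C) s 1 erefl (cderive_horizontal s om).
by rewrite mulr1.
Qed.

Lemma cderive_kern_vertical (s om : R) : 0 < s ->
  cderive (fun om => kern (s +i* om)%C) om (kern' (s +i* om)%C * 'i%C).
Proof.
move=> s0; have [n1 n2] := rhp_neq om s0.
have dk := cdiff_kern (ltW s0 : 0 <= Re (s +i* om)%C) n1 n2.
exact: (dk (fun om => (s +i* om)%C) om 'i%C erefl (cderive_vertical s om)).
Qed.

(** Cauchy-Riemann: the derivative of [Re kern] across the line is the derivative of [Im kern] along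
    it, so its integral reduces to boundary terms. *)
Lemma is_derive_Im_kern (s om : R) : 0 < s ->
  is_derive om 1 (fun om => Im (kern (s +i* om)%C)) (Re (kern' (s +i* om)%C)).
Proof.
move=> s0; have [_] := cderive_kern_vertical om s0.
by rewrite ImiRe.
Qed.

Lemma continuous_Re_kern (s : R) : 0 < s -> continuous (fun om => Re (kern (s +i* om)%C)).
Proof. by move=> s0 om; have [/derive_continuous] := cderive_kern_vertical om s0. Qed.

(** Serves only the continuity of [kern'] along vertical lines, demanded by the fundamental theorem
    of calculus; the value of the second derivative is left unspecified. *)
Lemma ex_cdiff_kern' (z : C) : 0 < Re z -> exists d, cdiff kern' z d.
Proof.
move=> z0.
have [n1 n2] : z - ilam != 0 /\ z + ilam != 0 by case: z z0 => s om; exact: rhp_neq.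
have z0' := ltW z0.
have p0 := delay_char_neq0 z0'.
have m0 := addlam_neq0 z0'.
have dk := cdiff_knum z0'.
have [dw hw] : exists d, cdiff (fun z => (z - ilam)^-1 * (z + ilam)^-1) z d.
  by eexists; apply: cdiffM; apply: cdiffV => //; exact: cdiff_addr.
have [ds hs] : exists d, cdiff (fun z => (z - ilam)^-1 + (z + ilam)^-1) z d.
  by eexists; apply: cdiffD; apply: cdiffV => //; exact: cdiff_addr.
have he := @cdiff_edelay z.
have hp := @cdiff_delay_char z.
have sq (K : C -> C) d : K z != 0 -> cdiff K z d ->
    exists d, cdiff (fun z => (K z ^+ 2)^-1) z d.
  move=> k0 hk; eexists; apply: (@cdiffV _ (fun z => K z ^+ 2)).
    by rewrite expf_neq0.
  exact: (cdiffM hk hk).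
have [dp2 hp2] := sq _ _ p0 hp.
have [dm2 hm2] := sq (fun z => z + lam%:C%C) 1 m0 (@cdiff_addr R _ _).
have [dp' hp'] : exists d, cdiff (delay_char') z d.
  eexists; apply: cdiff_shift; apply: cdiff_scale.
  by apply: cdiffM; [exact: he|exact: cdiff_cst].
have [dn hn] : exists d, cdiff (knum') z d.
  eexists; apply: cdiffD.
    apply: cdiff_scale; apply: cdiffD.
      apply: cdiffM; last by apply: cdiffV; [exact: p0|exact: hp].
      by apply: cdiffM; [exact: he|exact: cdiff_cst].
    apply: cdiffM; first exact: he.
    by apply: cdiffN; apply: cdiffM; [exact: hp'|exact: hp2].
  apply: cdiff_scale; apply: cdiff_scale; apply: cdiffN.
  by apply: cdiff_scale; exact: hm2.
eexists; apply: cdiffD; first by apply: cdiffM; [exact: hn|exact: hw].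
apply: cdiffN; apply: cdiffM; first exact: dk.
by apply: cdiffM; [exact: hs|exact: hw].
Qed.

Lemma continuous_Re_kern' (s : R) : 0 < s -> continuous (fun om => Re (kern' (s +i* om)%C)).
Proof.
move=> s0 om; have [d hd] := @ex_cdiff_kern' (s +i* om)%C s0.
have [/derive_continuous h _] := hd (fun om => (s +i* om)%C) om 'i%C erefl (cderive_vertical s om).
exact: h.
Qed.

Let Phi (s : R) : R := (\int[mu]_om Re (kern (s +i* om)%C))%R.

Lemma Rintegral_kern' (s : R) : 0 < s -> (\int[mu]_om Re (kern' (s +i* om)%C))%R = 0.
Proof.
move=> s0.
have [A A0 hA] := kern_bound.
have [B B0 hB] := kern'_bound s0.
apply: (@Rintegral_derive0 R (fun om => Im (kern (s +i* om)%C)) (fun om => Re (kern' (s +i* om)%C)) A B).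
- by move=> om; exact: is_derive_Im_kern.
- exact: continuous_Re_kern'.
- move=> om; apply: le_trans (normr_Im_le _) _.
  by have [n1 n2] := rhp_neq om s0; apply: hA => //=; exact: ltW.
- by move=> om; apply: le_trans (normr_Re_le _) _; exact: hB.
Qed.

Lemma measurable_Re_kern (s : R) : 0 < s ->
  measurable_fun setT (fun om => Re (kern (s +i* om)%C)).
Proof. by move=> s0; apply: continuous_measurable_fun; exact: continuous_Re_kern. Qed.

Lemma integrable_Re_kern (s : R) : 0 < s ->
  mu.-integrable setT (EFin \o (fun om => Re (kern (s +i* om)%C))).
Proof.
move=> s0; have [A A0 hA] := kern_bound.
apply: (@integrableT_of_le _ _ A); first exact: measurable_Re_kern.
move=> om; apply: le_trans (normr_Re_le _) _.
by have [n1 n2] := rhp_neq om s0; apply: hA => //=; exact: ltW.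
Qed.

Lemma is_derive_Phi (s : R) : 0 < s -> is_derive s 1 Phi 0.
Proof.
move=> s0.
(* All lines in the window []s / 2, s + 1[] stay at distance [s / 2] from the axis, so one bound on
   [kern'] dominates the difference quotients. *)
have s20 : 0 < s / 2 by rewrite divr_gt0.
have [B B0 hB] := kern'_bound s20.
pose f (s om : R) := Re (kern (s +i* om)%C).
pose G (om : R) := B * (1 + om ^+ 2)^-1.
have G0 om : 0 <= G om by rewrite mulr_ge0// invr_ge0 addr_ge0// sqr_ge0.
have Ia : `]s / 2, s + 1[%classic s.
  by rewrite /= in_itv/=; apply/andP; split; lra.
have I0 t : `]s / 2, s + 1[%classic t -> 0 < t.
  by rewrite /= in_itv/= => /andP[h _]; exact: lt_trans h.
have intf t : `]s / 2, s + 1[%classic t -> mu.-integrable setT (EFin \o f t).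
  by move=> /I0; exact: integrable_Re_kern.
have derf t om : `]s / 2, s + 1[%classic t -> setT om -> derivable (f ^~ om) t 1.
  by move=> /I0 t0 _; exact: (is_derive_derivable (is_derive_Re_kern om t0)).
have intG : mu.-integrable setT (EFin \o G).
  apply: (@integrableT_of_le _ _ B); last by move=> om; rewrite ger0_norm.
  apply: continuous_measurable_fun => om; apply: cvgMl_tmp.
  by have := @continuous_lorentz R 1 ltr01 om; rewrite expr1n.
have dE t om : 0 < t -> partial1of2 f t om = Re (kern' (t +i* om)%C).
  by move=> t0; exact: (is_derive_derive1 (is_derive_Re_kern om t0)).
have Gub t om : `]s / 2, s + 1[%classic t -> setT om -> `|partial1of2 f t om| <= G om.
  move=> It _; rewrite dE; last exact: I0.
  apply: le_trans (normr_Re_le _) _; apply: (hB (t +i* om)%C) => /=.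
  by move: It; rewrite /= in_itv/= => /andP[/ltW].
apply: DeriveDef.
  exact: (@derivable_under_integral R _ _ mu f setT measurableT s _ _ Ia intf derf G G0 intG Gub).
rewrite -derive1E.
rewrite (@differentiation_under_integral R _ _ mu f setT measurableT s _ _ Ia intf derf G G0 intG Gub).
rewrite -[RHS](Rintegral_kern' s0); apply: eq_Rintegral => om _.
exact: dE.
Qed.

Lemma Phi_cst (a b : R) : 0 < a -> a <= b -> Phi a = Phi b.
Proof.
move=> a0; rewrite le_eqVlt => /orP[/eqP ->//|ab].
have [||t _] := @MVT R Phi (fun=> 0) a b ab.
- move=> t; rewrite in_itv/= => /andP[at_ _]; apply: is_derive_Phi.
  exact: lt_trans at_.
- apply: derivable_within_continuous => t; rewrite in_itv/= => /andP[at_ _].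
  exact: (is_derive_derivable (is_derive_Phi (lt_le_trans a0 at_))).
by rewrite mul0r => /subr0_eq.
Qed.

Lemma integrable_scaled_lorentz (A : R) : 0 <= A ->
  mu.-integrable setT (EFin \o (fun om : R => A * (1 + om ^+ 2)^-1)).
Proof.
move=> A0; apply: (@integrableT_of_le _ _ A); last first.
  by move=> om; rewrite ger0_norm// mulr_ge0// invr_ge0 addr_ge0// sqr_ge0.
apply: continuous_measurable_fun => om; apply: cvgMl_tmp.
by have := @continuous_lorentz R 1 ltr01 om; rewrite expr1n.
Qed.

(** [Phi] takes the same value at every [n.+1]; there the integrand is at most [B0 / n.+1 ^ 2], and
    [kern_bound] dominates it independently of [n]. *)
Lemma Phi1 : Phi 1 = 0.
Proof.
have [A A0 hA] := kern_bound.
have [B0 B00 b0] := bounded_rhp_ge0 (bounded_knum).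
have n0 (n : nat) : 0 < n.+1%:R :> R by [].
have [|||||_ c1] := @dominated_cvg_Rintegral R (fun n om => Re (kern (n.+1%:R +i* om)%C))
  (fun=> 0) (fun om => A * (1 + om ^+ 2)^-1).
- by move=> n; exact: measurable_Re_kern.
- by [].
- apply: aeW => om; apply: norm_cvg0.
  apply: (@squeeze_cvgr _ _ _ _ (cst 0) (fun n => B0 * (n.+1%:R ^+ 2)^-1)).
  + near=> n; apply/andP; split; first exact: normr_ge0.
    apply: le_trans (normr_Re_le _) _.
    rewrite /kern normcM ler_pM ?normc_ge0 ?b0//.
    have low d : Re d = 0 -> n.+1%:R <= normc ((n.+1%:R +i* om)%C + d).
      move=> d0; apply: le_trans (normr_Re_le _); apply: le_trans (ler_norm _).
      by rewrite cReD d0 addr0.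
    have [n1 n2] := rhp_neq om (n0 n).
    rewrite normcM !normcV expr2 invfM ler_pM ?invr_ge0 ?normc_ge0//.
      by rewrite lef_pV2 ?posrE ?normc_gt0// low//= oppr0.
    by rewrite lef_pV2 ?posrE ?normc_gt0// low.
  + exact: cvg_cst.
  + rewrite -[0 in X in _ --> X](mulr0 B0); apply: cvgMl_tmp.
    apply: (@squeeze_cvgr _ _ _ _ (cst 0) (@harmonic R)); last 2 first.
    * exact: cvg_cst.
    * exact: cvg_harmonic.
    near=> n; rewrite /= invr_ge0 sqr_ge0/= /harmonic lef_pV2 ?posrE ?exprn_gt0//.
    by rewrite expr2 ler_peMr// ler1n.
- exact: integrable_scaled_lorentz.
- move=> n om; apply: le_trans (normr_Re_le _) _.
  by have [n1 n2] := rhp_neq om (n0 n); apply: hA => //=; exact: ltW.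
have c2 : Phi n.+1%:R @[n --> \oo] --> Phi 1.
  apply: cvg_near_cst; near=> n; apply/esym/Phi_cst => //.
  by rewrite ler1n.
have c1' : Phi n.+1%:R @[n --> \oo] --> (0 : R).
  have e0 : (\int[mu]_om (0 : R))%R = 0 :> R by rewrite /Rintegral integral0.
  by rewrite -e0.
exact: (cvg_unique _ c2 c1').
Unshelve. all: by end_near. Qed.

Definition delay_den (om : R) : R :=
  (lam * cos (tau * om)) ^+ 2 + (om - lam * sin (tau * om)) ^+ 2.

Lemma delay_denE (om : R) : delay_den om = normc (delay_char (0 +i* om)%C) ^+ 2.
Proof. by rewrite normcE2 delay_char_axis. Qed.

Lemma delay_den_gt0 (om : R) : 0 < delay_den om.
Proof.
have p0 := delay_char_neq0 (lexx 0 : 0 <= Re (0 +i* om)%C).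
by rewrite delay_denE exprn_gt0// normc_gt0.
Qed.

Lemma continuous_delay_den : continuous delay_den.
Proof.
have -> : delay_den = (fun om => Re (delay_char (0 +i* om)%C) * Re (delay_char (0 +i* om)%C) +
    Im (delay_char (0 +i* om)%C) * Im (delay_char (0 +i* om)%C)).
  by apply/funext => om; rewrite delay_denE normcE2 !expr2.
move=> om.
have [/derive_continuous c1 /derive_continuous c2] := @cdiff_delay_char (0 +i* om)%C
  (fun om => (0 +i* om)%C) om 'i%C erefl (cderive_vertical 0 om).
by apply: cvgD; apply: cvgM; [exact: c1|exact: c1|exact: c2|exact: c2].
Qed.

Lemma continuous_delay_denV : continuous (fun om => (delay_den om)^-1).
Proof.
move=> om; apply: cvgV; last exact: continuous_delay_den.
by rewrite gt_eqF// delay_den_gt0.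
Qed.

Lemma delay_den_lorentz :
  mu.-integrable setT
    (EFin \o (fun om : R => (delay_den om)^-1 - delay_gain * (lam ^+ 2 + om ^+ 2)^-1)) /\
  (\int[mu]_om ((delay_den om)^-1 - delay_gain * (lam ^+ 2 + om ^+ 2)^-1))%R = 0.
Proof.
have [A A0 hA] := kern_bound.
have n0 (n : nat) : 0 < @harmonic R n by rewrite invr_gt0.
have [|||||ih c1] := @dominated_cvg_Rintegral R (fun n om => Re (kern (@harmonic R n +i* om)%C))
  (fun om : R => (delay_den om)^-1 - delay_gain * (lam ^+ 2 + om ^+ 2)^-1)
  (fun om => A * (1 + om ^+ 2)^-1).
- by move=> n; exact: measurable_Re_kern.
- apply: continuous_measurable_fun => om; apply: cvgB; first exact: continuous_delay_denV.
  by apply: cvgMl_tmp; exact: continuous_lorentz.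
- exists [set lam; - lam]; split.
  + by apply: measurableU; exact: measurable_set1.
  + exact: (countable_lebesgue_measure0 (finite_set_countable (finite_set2 _ _))).
  + move=> om /= h; apply: contrapT => oml; apply: h.
    have oml2 : om ^+ 2 != lam ^+ 2.
      rewrite eqf_sqr negb_or; apply/andP; split; apply/eqP => e; apply: oml; first by left.
      by right.
    have [m1 m2] := axis_neq oml2.
    rewrite -(Re_kern_axis oml2).
    (* Differentiability is available at the boundary point itself, which gives the limit as the
       abscissa [1 / n.+1] tends to [0]. *)
    have dk := cdiff_kern (lexx 0 : 0 <= Re (0 +i* om)%C) m1 m2.
    have [/derive_continuous c _] := dk (fun s => (s +i* om)%C) 0 1 erefl (cderive_horizontal 0 om).
    apply: (@cvg_comp _ _ _ (@harmonic R) (fun s => Re (kern (s +i* om)%C)) _ _ _ (@cvg_harmonic R)).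
    exact: c.
- exact: integrable_scaled_lorentz.
- move=> n om; apply: le_trans (normr_Re_le _) _.
  by have [m1 m2] := rhp_neq om (n0 n); apply: hA => //=; exact: ltW.
split; first exact: ih.
have c2 : Phi (@harmonic R n) @[n --> \oo] --> (0 : R).
  apply: cvg_near_cst; near=> n; rewrite -Phi1; apply: Phi_cst => //.
  by rewrite /harmonic invf_le1// ler1n.
exact: (cvg_unique _ c1 c2).
Unshelve. all: by end_near. Qed.

Lemma integrable_delay_denV : mu.-integrable setT (EFin \o (fun om : R => (delay_den om)^-1)).
Proof.
have [i1 _] := delay_den_lorentz.
have i2 := integrableZl measurableT delay_gain (integrable_lorentz lam_gt0).
have := integrableD measurableT i1 i2.
by apply: eq_integrable => // om _ /=; rewrite -EFinD subrK.
Qed.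

Lemma Rintegral_delay_denV :
  (\int[mu]_om (delay_den om)^-1)%R = pi / lam * delay_gain.
Proof.
have [i1 e1] := delay_den_lorentz.
have i2 := integrable_lorentz lam_gt0.
have i3 : mu.-integrable setT (EFin \o (fun om : R => delay_gain * (lam ^+ 2 + om ^+ 2)^-1)).
  by have := integrableZl measurableT delay_gain i2; apply: eq_integrable.
have := RintegralB measurableT integrable_delay_denV i3.
rewrite e1 RintegralZl// Rintegral_lorentz// => /esym/subr0_eq ->.
by rewrite mulrC.
Qed.

End DelayKernel.

(** * Spectral resolution of symmetric matrices *)

Section SpectralResolution.
Variables (R : realType) (n : nat).
Local Notation Re := complex.Re.
Local Notation Im := complex.Im.

Lemma cRe_sum (I : Type) (r : seq I) (P : pred I) (F : I -> R[i]) :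
  Re (\sum_(i <- r | P i) F i) = \sum_(i <- r | P i) Re (F i).
Proof. exact: (big_morph _ (@cReD R) erefl). Qed.

(* The real parts of the complex rank-one spectral projectors are still
   symmetric, still satisfy [A Q = l Q] and still sum to the identity; grouping
   them by eigenvalue restores orthogonality. *)
Lemma spectral_resolution (A : 'M[R]_n) : A^T = A ->
  exists (s : seq R) (P : R -> 'M[R]_n),
    [/\ uniq s, forall l, l \in s -> P l != 0,
        forall l, A *m P l = l *: P l, forall l, (P l)^T = P l &
        \sum_(l <- s) P l = 1%:M].
Proof.
move=> Asym.
pose AC := cmx A.
have AC_herm : AC \is hermsymmx.
  apply/is_hermitianmxP; rewrite expr0 scale1r; apply/matrixP => i j; rewrite !mxE.
  have -> : A i j = A j i by rewrite -{1}Asym mxE.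
  by apply: complex_eq => //=; rewrite oppr0.
have AC_normal := hermitian_normalmx AC_herm.
have dreal := hermitian_spectral_diag_real AC_herm.
have /orthomx_spectralP ACE := AC_normal.
have Uu := spectral_unitarymx AC.
have Uunit := spectral_unit AC.
have UV := invmx_unitary Uu.
set U := spectralmx AC in ACE Uu Uunit UV.
set d := spectral_diag AC in ACE dreal.
pose dr i : R := Re (d 0 i).
have drE i : d 0 i = (dr i)%:C%C.
  by rewrite /dr RRe_real//; move/mxOverP : dreal; exact.
pose Q i : 'M[R]_n := \matrix_(a, b) Re (conjc (U i a) * U i b).
have VE a i : (invmx U) a i = conjc (U i a) by rewrite UV !mxE.
have Qsym i : (Q i)^T = Q i.
  by apply/matrixP => a b; rewrite !mxE !cReM; case: (U i a) => ? ?; case: (U i b) => ? ? /=; ring.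
have Qsum : \sum_i Q i = 1%:M.
  apply/matrixP => a b; rewrite summxE.
  under eq_bigr do rewrite mxE -VE.
  rewrite -cRe_sum.
  have := mulVmx Uunit => /matrixP/(_ a b); rewrite !mxE => ->.
  by case: (a == b).
have AQ i : A *m Q i = dr i *: Q i.
  (* Column [i] of [invmx U] is an eigenvector; as [A] and the eigenvalue are real, taking real
     parts of the rank-one products preserves the eigenvalue equation. *)
  have AUV : AC *m invmx U = invmx U *m diag_mx d by rewrite ACE mulmxK.
  apply/matrixP => a b; rewrite !mxE.
  move/matrixP : AUV => /(_ a i); rewrite mul_mx_diag !mxE => /(congr1 (fun x => x * U i b)).
  rewrite mulr_suml => /(congr1 (@complex.Re R)); rewrite cRe_sum.
  rewrite VE drE -mulrA [_%:C%C * _]mulrC mulrA cReMr mulrC => <-.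
  apply: eq_bigr => c _; rewrite !mxE VE.
  by rewrite -mulrA [in RHS]mulrC cReMr mulrC.
pose P l : 'M[R]_n := \sum_(i | dr i == l) Q i.
(* The filter gives [P l != 0] by construction, which later certifies that [l] is an eigenvalue. *)
pose s := [seq l <- undup (codom dr) | P l != 0].
exists s, P; split.
- by rewrite filter_uniq// undup_uniq.
- by move=> l; rewrite mem_filter => /andP[].
- move=> l; rewrite /P mulmx_sumr scaler_sumr; apply: eq_bigr => i /eqP <-.
  exact: AQ.
- by move=> l; rewrite /P linear_sum; apply: eq_bigr => i _; exact: Qsym.
- rewrite big_filter -Qsum.
  transitivity (\sum_(l <- undup (codom dr)) P l).
    rewrite [RHS](bigID (fun l => P l != 0)) /= [X in _ = _ + X]big1 ?addr0//.
    by move=> l /negPn/eqP.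
  rewrite /P (exchange_big_dep predT)//=; apply: eq_bigr => i _.
  rewrite big_mkcond (bigD1_seq (dr i)) ?undup_uniq ?mem_undup ?codom_f//= eqxx.
  by rewrite big1 ?addr0// => l; rewrite eq_sym => /negbTE ->.
Qed.

End SpectralResolution.

Section SpectralCalculus.
Variables (K : fieldType) (n : nat) (T : eqType) (s : seq T) (P : T -> 'M[K]_n).
Hypothesis s_uniq : uniq s.
Hypothesis P_orth : forall l k, l \in s -> k \in s -> l != k -> P l *m P k = 0.
Hypothesis P_sum : \sum_(l <- s) P l = 1%:M.

(** The index type is kept apart from the field so that the same real spectrum indexes both the real
    projectors and their complexifications. *)
Definition fcalc (f : T -> K) : 'M[K]_n := \sum_(l <- s) f l *: P l.

(** Multiplying the resolution of the identity by [P l] leaves one term, by orthogonality. *)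
Lemma projector_idem l : l \in s -> P l *m P l = P l.
Proof.
move=> ls; rewrite -[RHS]mulmx1 -P_sum mulmx_sumr (bigD1_seq l)//=.
by rewrite big_seq_cond big1 ?addr0// => k /andP[ks kl]; rewrite P_orth// eq_sym.
Qed.

Lemma eq_fcalc f g : {in s, f =1 g} -> fcalc f = fcalc g.
Proof.
by move=> fg; rewrite /fcalc big_seq [RHS]big_seq; apply: eq_bigr => l /fg ->.
Qed.

Lemma fcalcP f l : l \in s -> fcalc f *m P l = f l *: P l.
Proof.
move=> ls; rewrite /fcalc mulmx_suml (bigD1_seq l)//= -scalemxAl projector_idem//.
rewrite big_seq_cond big1 ?addr0// => k /andP[ks kl].
by rewrite -scalemxAl P_orth// scaler0.
Qed.

Lemma fcalcM f g : fcalc f *m fcalc g = fcalc (fun l => f l * g l).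
Proof.
rewrite {2}/fcalc mulmx_sumr /fcalc big_seq [RHS]big_seq; apply: eq_bigr => l ls.
by rewrite -scalemxAr fcalcP// scalerA mulrC.
Qed.

Lemma fcalc1 : fcalc (fun=> 1) = 1%:M.
Proof. by rewrite -P_sum; apply: eq_bigr => l _; rewrite scale1r. Qed.

Lemma fcalcD f g : fcalc f + fcalc g = fcalc (fun l => f l + g l).
Proof. by rewrite /fcalc -big_split; apply: eq_bigr => l _; rewrite scalerDl. Qed.

Lemma fcalcZ a f : a *: fcalc f = fcalc (fun l => a * f l).
Proof. by rewrite /fcalc scaler_sumr; apply: eq_bigr => l _; rewrite scalerA. Qed.

Lemma fcalcN f : - fcalc f = fcalc (fun l => - f l).
Proof. by rewrite /fcalc -sumrN; apply: eq_bigr => l _; rewrite scaleNr. Qed.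

Lemma fcalcX f k : fcalc f ^+ k = fcalc (fun l => f l ^+ k).
Proof.
elim: k => [|k IH]; first by rewrite expr0 -idmxE -fcalc1.
by rewrite exprS IH -mulmxE fcalcM; apply: eq_fcalc => l _; rewrite exprS.
Qed.

Lemma fcalc_eigen (A : 'M[K]_n) f :
  (forall l, l \in s -> A *m P l = f l *: P l) -> A = fcalc f.
Proof.
move=> AP; rewrite -[A]mulmx1 -P_sum mulmx_sumr /fcalc big_seq [RHS]big_seq.
by apply: eq_bigr => l /AP.
Qed.

Lemma invmx_fcalc f : (forall l, l \in s -> f l != 0) ->
  invmx (fcalc f) = fcalc (fun l => (f l)^-1).
Proof.
move=> f0; have fV : fcalc f *m fcalc (fun l => (f l)^-1) = 1%:M.
  by rewrite fcalcM -fcalc1; apply: eq_fcalc => l ls; rewrite divff// f0.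
have [fu _] := mulmx1_unit fV.
by rewrite -[LHS]mulmx1 -fV mulKmx.
Qed.

Lemma trmx_fcalc f : (forall l, (P l)^T = P l) -> (fcalc f)^T = fcalc f.
Proof.
by move=> Pt; rewrite /fcalc linear_sum; apply: eq_bigr => l _; rewrite /= linearZ /= Pt.
Qed.

End SpectralCalculus.

(** By symmetry [P l *m A = l *: P l] too, so [P l *m A *m P k] is both [l] and [k] times
    [P l *m P k]. *)
Lemma projectors_orth (K : fieldType) (n : nat) (A : 'M[K]_n) (P : K -> 'M[K]_n) :
  A^T = A -> (forall l, A *m P l = l *: P l) -> (forall l, (P l)^T = P l) ->
  forall l k, l != k -> P l *m P k = 0.
Proof.
move=> At AP Pt l k lk.
have PA : P l *m A = l *: P l.
  by apply: trmx_inj; rewrite trmx_mul At Pt AP linearZ /= Pt.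
have : (l - k) *: (P l *m P k) = 0.
  by rewrite scalerBl scalemxAl -PA -mulmxA AP scalemxAr subrr.
by move/eqP; rewrite scaler_eq0 subr_eq0 (negbTE lk) => /eqP.
Qed.

(** * Uniqueness of the Moore-Penrose inverse *)

Section PseudoInverse.
Variables (R : realType) (n : nat).

(** [X Y] and [X Z] are both the orthogonal projector onto the range of [X], and [Y X], [Z X] that
    onto its row space; hence [Y = Y X Y = Y X Z = Z X Z = Z]. *)
Lemma is_mp_pinv_unique (X Y Z : 'M[R]_n) : is_mp_pinv X Y -> is_mp_pinv X Z -> Y = Z.
Proof.
move=> [y1 y2 y3 y4] [z1 z2 z3 z4].
have XYZ : X *m Y = X *m Z.
  transitivity (X *m Z *m (X *m Y)); first by rewrite mulmxA z1.
  by rewrite -[in LHS]z3 -[in LHS]y3 -trmx_mul mulmxA y1 z3.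
have YXZ : Y *m X = Z *m X.
  transitivity (Y *m X *m (Z *m X)); first by rewrite -mulmxA (mulmxA X) z1.
  by rewrite -[in LHS]z4 -[in LHS]y4 -trmx_mul -mulmxA (mulmxA X) y1 z4.
by rewrite -y2 -mulmxA XYZ mulmxA YXZ z2.
Qed.

Lemma pinvE (X Y : 'M[R]_n) : is_mp_pinv X Y -> Defs.pinv X = Y.
Proof.
by move=> XY; apply: xget_unique => // Z XZ; exact: is_mp_pinv_unique XZ XY.
Qed.

End PseudoInverse.

(** * The network *)

Section Laplacian.
Variables (R : realType) (n m : nat) (src dst : 'I_m -> 'I_n) (w : 'I_m -> R).
Local Notation E := (@incidence R n m src dst).
Local Notation L := (laplacian src dst w).

Lemma incidence_trmxE p (X : 'M[R]_(n, p)) k j :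
  (E^T *m X) k j = X (src k) j - X (dst k) j.
Proof.
rewrite mxE; under eq_bigr do rewrite !mxE mulrBl.
rewrite sumrB (bigD1 (src k))//= eqxx mul1r big1 ?addr0; last first.
  by move=> i /negbTE ->; rewrite mul0r.
rewrite (bigD1 (dst k))//= eqxx mul1r big1 ?addr0//.
by move=> i /negbTE ->; rewrite mul0r.
Qed.

Lemma trmx_laplacian : L^T = L.
Proof. by rewrite /laplacian !trmx_mul trmxK tr_diag_mx mulmxA. Qed.

Lemma laplacian_quad (v : 'cV[R]_n) :
  (v^T *m L *m v) 0 0 = \sum_k w k * (v (src k) 0 - v (dst k) 0) ^+ 2.
Proof.
have -> : v^T *m L *m v = (E^T *m v)^T *m (weightmx w *m (E^T *m v)).
  by rewrite /laplacian trmx_mul trmxK !mulmxA.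
rewrite mxE; apply: eq_bigr => k _.
have e := incidence_trmxE v k 0; move: (E^T *m v) e => y e.
by rewrite mul_diag_mx !mxE e; ring.
Qed.

Lemma laplacian_const p : L *m (const_mx 1 : 'M[R]_(n, p)) = 0.
Proof.
rewrite /laplacian -mulmxA [_^T *m _](_ : _ = 0) ?mulmx0//.
by apply/matrixP => k j; rewrite incidence_trmxE !mxE subrr.
Qed.

Hypothesis w_gt0 : forall k, 0 < w k.

(** The quadratic form is a sum of nonnegative edge terms, so each edge difference vanishes, and
    equality spreads along paths. *)
Lemma laplacian_ker (v : 'cV[R]_n) : connected_graph src dst -> L *m v = 0 ->
  forall i j, v i 0 = v j 0.
Proof.
move=> conn Lv.
have q0 : \sum_k w k * (v (src k) 0 - v (dst k) 0) ^+ 2 = 0.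
  by rewrite -laplacian_quad -mulmxA Lv mulmx0 mxE.
have edge k : v (src k) 0 = v (dst k) 0.
  have /eqP := q0; rewrite psumr_eq0; last first.
    by move=> l _; rewrite mulr_ge0 ?sqr_ge0// ltW.
  move=> /allP/(_ k); rewrite mem_index_enum => /(_ isT)/=.
  by rewrite mulf_eq0 gt_eqF//= sqrf_eq0 subr_eq0 => /eqP.
move=> i j; have /connectP[p] := conn i j.
elim: p i => [i _ ->//|k p IH i /= /andP[/existsP[e he] pk] lj].
rewrite -(IH k pk lj).
by case/orP: he => /andP[/eqP <- /eqP <-]; rewrite edge.
Qed.

(** Rayleigh quotient of a nonzero column of [X]. *)
Lemma laplacian_eigen_ge0 (l : R) (X : 'M[R]_n) : L *m X = l *: X -> X != 0 -> 0 <= l.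
Proof.
move=> LX X0.
have [j Xj] : exists j, col j X != 0.
  apply/existsP; apply: contraR X0; rewrite negb_exists => /forallP h.
  apply/eqP/matrixP => i j; move: (h j) => /negPn/eqP/matrixP/(_ i 0).
  by rewrite !mxE.
set v := col j X in Xj.
have Lv : L *m v = l *: v by rewrite /v !colE mulmxA LX scalemxAl.
have q : 0 <= (v^T *m L *m v) 0 0.
  by rewrite laplacian_quad sumr_ge0// => k _; rewrite mulr_ge0 ?sqr_ge0// ltW.
have vv : 0 < (v^T *m v) 0 0.
  rewrite lt_def; apply/andP; split; last first.
    by rewrite mxE sumr_ge0// => k _; rewrite mxE -expr2 sqr_ge0.
  apply: contra Xj; rewrite mxE psumr_eq0; last first.
    by move=> k _; rewrite mxE -expr2 sqr_ge0.
  move=> /allP h; apply/eqP/matrixP => k z; rewrite ord1 [RHS]mxE.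
  have := h k; rewrite mem_index_enum => /(_ isT)/=.
  by rewrite mxE -expr2 sqrf_eq0 => /eqP.
by move: q; rewrite -mulmxA Lv -scalemxAr mxE pmulr_lge0.
Qed.

End Laplacian.

(** * Finite combinations of integrals, and integrands altered at one point *)

Section LinearCombination.
Variable R : realType.
Local Notation mu := (@lebesgue_measure R).

Lemma Rintegral_lincomb (I : eqType) (s : seq I) (c : I -> R) (f : I -> R -> R) :
  {in s, forall i, mu.-integrable setT (EFin \o f i)} ->
  mu.-integrable setT (EFin \o (fun x => \sum_(i <- s) c i * f i x)) /\
  (\int[mu]_x \sum_(i <- s) c i * f i x)%R = \sum_(i <- s) c i * (\int[mu]_x f i x)%R.
Proof.
elim: s => [|i s IH] h.
  rewrite big_nil; split.
    under eq_fun do rewrite big_nil.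
    exact: integrable0.
  under eq_Rintegral do rewrite big_nil.
  by rewrite /Rintegral integral0.
have [i1 e1] : mu.-integrable setT (EFin \o (fun x => \sum_(i <- s) c i * f i x)) /\
  (\int[mu]_x \sum_(i <- s) c i * f i x)%R = \sum_(i <- s) c i * (\int[mu]_x f i x)%R.
  by apply: IH => k ks; apply: h; rewrite inE ks orbT.
have i2 : mu.-integrable setT (EFin \o f i) by apply: h; rewrite inE eqxx.
have i3 : mu.-integrable setT (EFin \o (fun x => c i * f i x)).
  by have := integrableZl measurableT (c i) i2; apply: eq_integrable.
split.
  by have := integrableD measurableT i3 i1; apply: eq_integrable => // x _ /=; rewrite big_cons.
under eq_Rintegral do rewrite big_cons.
rewrite RintegralD// big_cons e1; congr (_ + _).
by rewrite RintegralZl.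
Qed.

(** Meant for the H2 integrand, whose modal formula is available only for [om != 0]. Measurability
    of [f] is derived, as [f] is [g] plus a multiple of the indicator of [0]. *)
Lemma integral_eq_off0 (f g : R -> R) : mu.-integrable setT (EFin \o g) ->
  (forall x, x != 0 -> f x = g x) ->
  mu.-integrable setT (EFin \o f) /\
  (\int[mu]_x (f x)%:E = \int[mu]_x (g x)%:E)%E.
Proof.
move=> ig fg.
have mg : measurable_fun setT g by have /integrableP[/measurable_EFinP] := ig.
have mf : measurable_fun setT f.
  have -> : f = (fun x => g x + (f 0 - g 0) * \1_[set 0] x).
    apply/funext => x; have [->|x0] := eqVneq x 0.
      by rewrite indicE mem_set// mulr1 addrC subrK.
    rewrite fg// indicE memNset ?mulr0 ?addr0//=.
    by move/eqP; rewrite (negbTE x0).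
  apply: measurable_funD => //; apply: measurable_funM => //.
have ae_fg : ae_eq mu setT (EFin \o f) (EFin \o g).
  exists [set 0]; split; [exact: measurable_set1|exact: lebesgue_measure_set1|].
  move=> x /= h; apply: contrapT => x0; apply: h => _.
  by rewrite fg//; apply/eqP.
split.
  apply/integrableP; split; first exact/measurable_EFinP.
  have /integrableP[_] := ig.
  rewrite (@ae_eq_integral _ _ _ mu setT (fun x => `|(EFin \o f) x|)%E (fun x => `|(EFin \o g) x|)%E)//.
  - by apply: measurableT_comp => //; exact/measurable_EFinP.
  - by apply: measurableT_comp => //; exact/measurable_EFinP.
  - by move: ae_fg; apply: filterS => x /= h _; have [->] := h I.
apply: ae_eq_integral => //; exact/measurable_EFinP.
Qed.

End LinearCombination.

(** * Matrix cosine and sine on spectral sums *)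

Section MatrixTrig.
Variables (R : realType) (n : nat) (s : seq R) (P : R -> 'M[R]_n).
Hypothesis s_uniq : uniq s.
Hypothesis P_orth : forall l k, l \in s -> k \in s -> l != k -> P l *m P k = 0.
Hypothesis P_sum : \sum_(l <- s) P l = 1%:M.

(** Partial sums stay in the span of the finitely many [P l], so convergence of matrices reduces to
    scalar convergence at each eigenvalue. *)
Lemma limn_series_fcalc (u : R -> nat -> R) (f : R -> R) :
  (forall l, series (u l) @ \oo --> f l) ->
  limn (series (fun k => fcalc s P (fun l => u l k))) = fcalc s P f.
Proof.
move=> uf; apply/cvg_lim; first exact: norm_hausdorff.
have -> : series (fun k => fcalc s P (fun l => u l k)) =
    (fun N : nat => \sum_(l <- s) series (u l) N *: P l).
  apply/funext => N; rewrite /series /= /fcalc exchange_big /=.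
  by apply: eq_bigr => l _; rewrite scaler_suml.
apply: cvg_big => [|l _]; first exact: add_continuous.
by apply: cvgZr_tmp; exact: uf.
Qed.

Lemma mxcos_fcalc (f : R -> R) : mxcos (fcalc s P f) = fcalc s P (fun l => cos (f l)).
Proof.
rewrite /mxcos -(@limn_series_fcalc (fun l => cos_coeff' (f l)) (fun l => cos (f l))); last first.
  by move=> l; exact: cvg_cos_coeff'.
congr (limn (series _)); apply/funext => k.
rewrite fcalcX// fcalcZ; apply: eq_fcalc => l _.
by rewrite /cos_coeff' mul2n [RHS]mulrAC.
Qed.

Lemma mxsin_fcalc (f : R -> R) : mxsin (fcalc s P f) = fcalc s P (fun l => sin (f l)).
Proof.
rewrite /mxsin -(@limn_series_fcalc (fun l => sin_coeff' (f l)) (fun l => sin (f l))); last first.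
  by move=> l; exact: cvg_sin_coeff'.
congr (limn (series _)); apply/funext => k.
rewrite fcalcX// fcalcZ; apply: eq_fcalc => l _.
by rewrite /sin_coeff' mul2n [RHS]mulrAC.
Qed.

End MatrixTrig.

Section ComplexMatrices.
Variable R : realType.
Local Notation Re := complex.Re.
Local Notation Im := complex.Im.

Lemma cmxM p q r (A : 'M[R]_(p, q)) (B : 'M[R]_(q, r)) : cmx (A *m B) = cmx A *m cmx B.
Proof. exact: (map_mxM (real_complex R)). Qed.

Lemma conj_cmx p q (A : 'M[R]_(p, q)) : map_mx (@conjc R) (cmx A) = cmx A.
Proof. by apply/matrixP => i j; rewrite !mxE conjc_real. Qed.

Lemma cmx_fcalc n (s : seq R) (P : R -> 'M[R]_n) (f : R -> R) :
  fcalc s (fun l => cmx (P l)) (fun l => (f l)%:C%C) = cmx (fcalc s P f).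
Proof.
apply/matrixP => i j; rewrite mxE !summxE rmorph_sum; apply: eq_bigr => l _.
by rewrite !mxE rmorphM.
Qed.

Lemma conj_fcalc n (s : seq R) (P : R -> 'M[R]_n) (f : R -> R[i]) :
  map_mx (@conjc R) (fcalc s (fun l => cmx (P l)) f) =
  fcalc s (fun l => cmx (P l)) (fun l => conjc (f l)).
Proof.
apply/matrixP => i j; rewrite mxE !summxE rmorph_sum; apply: eq_bigr => l _.
by rewrite !mxE rmorphM; congr (_ * _); exact: conjc_real.
Qed.

Lemma conj_inv_mul (z : R[i]) : conjc z^-1 * z^-1 = ((normc z ^+ 2)^-1)%:C%C.
Proof.
rewrite conjc_inv -invfM fmorphV; congr (_^-1).
by rewrite normcE2; case: z => a b; apply: complex_eq => /=; ring.
Qed.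

Lemma mxtrace_cmx p (A : 'M[R]_p) : \tr (cmx A) = (\tr A)%:C%C.
Proof. exact: (trace_map_mx (real_complex R)). Qed.

End ComplexMatrices.

(** * Modal decomposition of the performance and of the effective resistance *)

Section Network.
Variables (R : realType) (n m : nat) (src dst : 'I_m -> 'I_n) (w : 'I_m -> R) (tau : R).
Local Notation Re := complex.Re.
Local Notation Im := complex.Im.
Local Notation mu := (@lebesgue_measure R).
Local Notation E := (@incidence R n m src dst).
Local Notation L := (laplacian src dst w).
Hypothesis conn : connected_graph src dst.
Hypothesis w_gt0 : forall k, 0 < w k.
Hypothesis tau_ge0 : 0 <= tau.
Hypothesis stable : forall lam : R, eigenvalue L lam -> tau * lam < pi / 2.
Variables (s : seq R) (P : R -> 'M[R]_n).
Hypothesis s_uniq : uniq s.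
Hypothesis P_neq0 : forall l, l \in s -> P l != 0.
Hypothesis LP : forall l, L *m P l = l *: P l.
Hypothesis P_sym : forall l, (P l)^T = P l.
Hypothesis P_sum : \sum_(l <- s) P l = 1%:M.

Let P_orth l k : l \in s -> k \in s -> l != k -> P l *m P k = 0.
Proof. by move=> _ _; exact: (projectors_orth (trmx_laplacian _ _ _) LP P_sym). Qed.

Let PC l := cmx (P l).

Let PC_orth l k : l \in s -> k \in s -> l != k -> PC l *m PC k = 0.
Proof.
move=> ls ks lk; rewrite /PC -cmxM P_orth//.
by apply/matrixP => i j; rewrite !mxE.
Qed.

Let PC_sum : \sum_(l <- s) PC l = 1%:M.
Proof.
apply/matrixP => i j; rewrite summxE /PC.
under eq_bigr do rewrite mxE.
rewrite -(rmorph_sum (real_complex R)) -summxE P_sum !mxE.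
by case: (i == j).
Qed.

Let PL l : P l *m L = l *: P l.
Proof. by apply: trmx_inj; rewrite trmx_mul trmx_laplacian P_sym LP linearZ /= P_sym. Qed.

Lemma spectrum_ge0 l : l \in s -> 0 <= l.
Proof. by move=> ls; exact: (laplacian_eigen_ge0 w_gt0 (LP l) (P_neq0 ls)). Qed.

Lemma spectrum_stable l : l \in s -> tau * l < pi / 2.
Proof.
move=> ls; apply: stable.
have [i Pi] : exists i, row i (P l) != 0.
  apply/existsP; apply: contraR (P_neq0 ls); rewrite negb_exists => /forallP h.
  by apply/eqP/row_matrixP => i; rewrite row0; exact/eqP/negPn/h.
apply/eigenvalueP; exists (row i (P l)) => //.
by rewrite !rowE -mulmxA PL scalemxAr.
Qed.

Lemma laplacian_fcalc : L = fcalc s P id.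
Proof. by apply: fcalc_eigen => // l _; exact: LP. Qed.

(** By connectedness the columns of [P 0] are constant, so centering kills them; the other modes are
    orthogonal to constants and are left fixed. *)
Lemma centering_fcalc : centering R n = fcalc s P (fun l => (l != 0)%:R).
Proof.
apply: fcalc_eigen => // l _; rewrite /centering mulmxBl mul1mx -scalemxAl.
have [->|l0] := eqVneq l 0.
  rewrite scale0r; apply/matrixP => i j; rewrite !mxE.
  have cst k : P 0 k j = P 0 i j.
    have L0 : L *m col j (P 0) = 0 by rewrite colE mulmxA LP scale0r mul0mx.
    by have := laplacian_ker w_gt0 conn L0 k i; rewrite !mxE.
  under eq_bigr do rewrite mxE mul1r cst.
  rewrite sumr_const card_ord -[P 0 i j *+ n]mulr_natl mulKf ?subrr//.
  by rewrite pnatr_eq0 -lt0n; exact: leq_ltn_trans (leq0n i) (ltn_ord i).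
have JL : (const_mx 1 : 'M[R]_n) *m L = 0.
  apply: trmx_inj; rewrite trmx_mul trmx_laplacian trmx_const trmx0.
  exact: laplacian_const.
have : l *: ((const_mx 1 : 'M[R]_n) *m P l) = 0 by rewrite scalemxAr -LP mulmxA JL mul0mx.
move/eqP; rewrite scaler_eq0 (negbTE l0) => /eqP ->.
by rewrite scaler0 subr0 scale1r.
Qed.

Definition noise_mx (sigma : 'I_m -> R) : 'M[R]_(n, m) :=
  E *m weightmx w *m diag_mx (\row_k sigma k).

(** For the zero mode [delay_char] is [i om], so [om != 0] makes the matrix invertible before
    centering removes that mode. *)
Lemma transferE sigma om : om != 0 -> transfer src dst w tau sigma om =
  fcalc s PC (fun l => ((l != 0)%:R * (delay_char l tau (0 +i* om)%C)^-1)) *m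
  cmx (noise_mx sigma).
Proof.
move=> om0; rewrite /transfer; congr (_ *m _).
have -> : (0 +i* om)%C%:M + (cos (tau * om) +i* - sin (tau * om))%C *: cmx L =
    fcalc s PC (fun l => delay_char l tau (0 +i* om)%C).
  rewrite -scalemx1 -(fcalc1 PC_sum) laplacian_fcalc -cmx_fcalc !fcalcZ fcalcD.
  by apply: eq_fcalc => l _; rewrite /delay_char edelay_axis mulr1 mulrC.
rewrite centering_fcalc -cmx_fcalc invmx_fcalc//.
  rewrite fcalcM//; apply: eq_fcalc => l _.
  by rewrite rmorph_nat.
move=> l ls; have [->|l0] := eqVneq l 0.
  by rewrite /delay_char mul0r addr0 eq_complex /= eqxx.
apply: delay_char_neq0 => //; last exact: spectrum_stable.
by rewrite lt_def l0 spectrum_ge0.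
Qed.

(** For [l] in the spectrum, the squared length of the projection of the incidence column of link
    [k] onto the eigenspace of [l]. *)
Definition link_energy (l : R) (k : 'I_m) : R := (E^T *m P l *m E) k k.

Lemma h2_integrandE sigma om : om != 0 -> h2_integrand src dst w tau sigma om =
  \sum_(l <- [seq l <- s | l != 0])
    (\sum_k sigma k ^+ 2 * (w k ^+ 2 * link_energy l k)) * (delay_den l tau om)^-1.
Proof.
move=> om0; rewrite /h2_integrand transferE// map_mxM conj_fcalc conj_cmx trmx_mul.
rewrite -mulmxA (mulmxA (fcalc _ _ _)^T) trmx_fcalc; last first.
  by move=> l; apply/matrixP => i j; rewrite !mxE -{1}(P_sym l) mxE.
rewrite fcalcM//.
rewrite [fcalc _ _ _](_ : _ = cmx (fcalc s P (fun l => (l != 0)%:R * (delay_den l tau om)^-1))); last first.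
  rewrite -cmx_fcalc; apply: eq_fcalc => l _.
  have [_|_] := eqVneq l 0; first by rewrite !mul0r mulr0.
  by rewrite !mul1r conj_inv_mul delay_denE.
rewrite (_ : (cmx (noise_mx sigma))^T = cmx (noise_mx sigma)^T); last first.
  by apply/matrixP => i j; rewrite !mxE.
rewrite -!cmxM mxtrace_cmx /=.
rewrite /fcalc mulmx_suml mulmx_sumr linear_sum /= big_filter [RHS]big_mkcond /=.
apply: eq_bigr => l _; have [_|l0] := eqVneq l 0.
  by rewrite /= mul0r scale0r mul0mx mulmx0 linear0.
rewrite mul1r -scalemxAl -scalemxAr linearZ /= mulrC; congr (_ * _).
transitivity (\tr (diag_mx (\row_k sigma k) *m (weightmx w *m
    (E^T *m P l *m E *m weightmx w *m diag_mx (\row_k sigma k))))).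
  by rewrite /noise_mx !trmx_mul !tr_diag_mx !mulmxA.
(* The weights and intensities are diagonal on both sides, so only diagonal entries of
   [E^T *m P l *m E] reach the trace: no cross terms between links, hence linearity in the
   variances. *)
apply: eq_bigr => k _; rewrite /link_energy.
move: (E^T *m P l *m E) => X.
by rewrite mul_diag_mx mxE mul_diag_mx mxE mul_mx_diag mxE mul_mx_diag !mxE; ring.
Qed.

(** The prefactor [1 / (2 pi)] meets [pi / l] times the gain; this is the origin of the factor [1/2]
    of the theorem. *)
Lemma h2_integral sigma :
  mu.-integrable setT (fun om => (h2_integrand src dst w tau sigma om)%:E) /\
  rho_ss src dst w tau sigma = \sum_k sigma k ^+ 2 *
    (2^-1 * w k ^+ 2 *
     \sum_(l <- [seq l <- s | l != 0]) delay_gain l tau / l * link_energy l k).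
Proof.
have good l : l \in [seq l <- s | l != 0] -> 0 < l /\ tau * l < pi / 2.
  rewrite mem_filter => /andP[l0 ls]; split; last exact: spectrum_stable.
  by rewrite lt_def l0 spectrum_ge0.
have [i1 e1] := @Rintegral_lincomb R _ [seq l <- s | l != 0]
  (fun l => \sum_k sigma k ^+ 2 * (w k ^+ 2 * link_energy l k))
  (fun l om => (delay_den l tau om)^-1)
  (fun l ls => integrable_delay_denV (good l ls).1 tau_ge0 (good l ls).2).
have [i2 e2] := @integral_eq_off0 R _ _ i1 (@h2_integrandE sigma).
split; first exact: i2.
rewrite /rho_ss e2; move: e1; rewrite {1}/Rintegral => ->.
under eq_big_seq => l ls.
  rewrite (Rintegral_delay_denV (good l ls).1 tau_ge0 (good l ls).2).
  over.
rewrite mulr_sumr.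
under eq_bigr do rewrite mulr_suml mulr_sumr.
rewrite exchange_big /=; apply: eq_bigr => k _.
rewrite mulrA mulr_sumr big_seq [RHS]big_seq; apply: eq_bigr => l ls.
have [l0 _] := good l ls; have p0 := pi_gt0 R.
move: (@pi R) p0 => q q0.
by field; rewrite !gt_eqF.
Qed.

Lemma quad_link (Y : 'M[R]_n) (e : 'I_m) : Y^T = Y ->
  (E^T *m Y *m E) e e = Y (src e) (src e) + Y (dst e) (dst e) - 2 * Y (src e) (dst e).
Proof.
move=> Yt; have Ys i j : Y i j = Y j i by rewrite -{1}Yt mxE.
have YE i : (Y *m E) i e = Y i (src e) - Y i (dst e).
  have -> : (Y *m E) i e = (E^T *m Y) e i by rewrite -[Y in RHS]Yt -trmx_mul [RHS]mxE.
  by rewrite incidence_trmxE !(Ys i).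
by rewrite -mulmxA incidence_trmxE !YE (Ys (dst e) (src e)); ring.
Qed.

(** On a mode [l != 0] the matrix acts as [l (1 - sin (tau l)) / cos (tau l)], which is [l] divided
    by the gain. Its pseudo-inverse therefore has exactly the modal coefficients of the delay
    integral, up to [pi]. *)
Lemma reff_delay (e : 'I_m) :
  reff (L *m invmx (mxcos (tau *: L)) *m (centering R n - mxsin (tau *: L)))
    (src e) (dst e) =
  \sum_(l <- [seq l <- s | l != 0]) delay_gain l tau / l * link_energy l e.
Proof.
pose xf l := l * (cos (tau * l))^-1 * ((l != 0)%:R - sin (tau * l)).
(* At [l = 0] this is [0] by the convention on inverses, as a pseudo-inverse requires since
   [xf 0 = 0]. *)
pose yf l := delay_gain l tau / l.
have -> : L *m invmx (mxcos (tau *: L)) *m (centering R n - mxsin (tau *: L)) = fcalc s P xf.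
  rewrite centering_fcalc laplacian_fcalc fcalcZ mxcos_fcalc// mxsin_fcalc// invmx_fcalc//.
    by rewrite fcalcN fcalcD !fcalcM.
  move=> l ls; rewrite gt_eqF//; apply: cos_gt0_pihalf; rewrite spectrum_stable// andbT.
  apply: (@lt_le_trans _ _ 0); last by rewrite mulr_ge0// spectrum_ge0.
  by rewrite oppr_lt0 divr_gt0// pi_gt0.
have xy l : l \in s -> l != 0 -> xf l * yf l = 1.
  move=> ls l0; have lp : 0 < l by rewrite lt_def l0 spectrum_ge0.
  have c0 := cos_delay_gt0 lp tau_ge0 (spectrum_stable ls).
  have s1 := sin_delay_lt1 lp tau_ge0 (spectrum_stable ls).
  rewrite /xf /yf /delay_gain l0 /= mulr1n.
  move: (cos _) (sin _) c0 s1 => c0 s0 c_gt0 s_lt1.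
  have s_neq1 : 1 - s0 != 0 by rewrite subr_eq0 eq_sym lt_eqF.
  by field; rewrite s_neq1 l0 gt_eqF.
have yP : is_mp_pinv (fcalc s P xf) (fcalc s P yf).
  split; rewrite ?fcalcM// ?trmx_fcalc//; apply: eq_fcalc => l ls.
    have [->|l0] := eqVneq l 0; first by rewrite /xf !mul0r.
    by rewrite xy// mul1r.
  have [->|l0] := eqVneq l 0; first by rewrite /yf invr0 !mulr0.
  by rewrite -mulrA xy// mulr1.
rewrite /reff (pinvE yP) -quad_link; last by rewrite trmx_fcalc.
rewrite /fcalc mulmx_sumr mulmx_suml summxE big_filter [RHS]big_mkcond /=.
apply: eq_bigr => l _; rewrite -scalemxAr -scalemxAl mxE.
by have [->|//] := eqVneq l 0; rewrite /yf invr0 mulr0 mul0r.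
Qed.

Lemma is_derive_rho_of_var (sigma : 'I_m -> R) (e : 'I_m) : 0 < sigma e ->
  is_derive (sigma e ^+ 2) 1 (rho_of_var src dst w tau sigma e)
    (2^-1 * w e ^+ 2 *
     \sum_(l <- [seq l <- s | l != 0]) delay_gain l tau / l * link_energy l e).
Proof.
move=> se0.
pose a k := 2^-1 * w k ^+ 2 *
  \sum_(l <- [seq l <- s | l != 0]) delay_gain l tau / l * link_energy l k.
pose c := \sum_(k | k != e) sigma k ^+ 2 * a k.
(* [Num.sqrt t] squares back to [t] only for [t >= 0], so the affine formula is used near the
   positive point [sigma e ^+ 2]. *)
apply: (@near_eq_is_derive R R^o R^o (fun t => a e * t + c)).
  near=> t; have t0 : 0 < t by near: t; apply: lt_nbhsr; rewrite exprn_gt0.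
  rewrite /rho_of_var (h2_integral _).2 (bigD1 e)//= /set_intensity eqxx.
  rewrite sqr_sqrtr ?ltW// mulrC; congr (_ + _).
  by apply: eq_bigr => k /negbTE ->.
have h1 := is_deriveM (is_derive_cst (a e) (sigma e ^+ 2) 1) (is_derive_id (sigma e ^+ 2) 1).
apply: (is_derive_eq (is_deriveD h1 (is_derive_cst c (sigma e ^+ 2) 1))).
by rewrite /GRing.scale/= mulr0 !addr0 mulr1.
Unshelve. all: by end_near. Qed.

End Network.

(** Integrability accompanies the derivative because [fine] in [rho_ss] would turn an infinite
    integral into [0]; it certifies that [rho_ss] is a genuine value. *)
Theorem theorem9 (R : realType) (n m : nat) (src dst : 'I_m -> 'I_n)
  (w : 'I_m -> R) (tau : R) :
  simple_graph src dst ->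
  connected_graph src dst ->
  (forall k, 0 < w k) ->
  0 <= tau ->
  (forall lam : R, eigenvalue (laplacian src dst w) lam -> tau * lam < pi / 2) ->
  forall sigma : 'I_m -> R, (forall k, 0 < sigma k) ->
    (@lebesgue_measure R).-integrable setT
       (fun om => (h2_integrand src dst w tau sigma om)%:E) /\
    forall e : 'I_m,
      let L := laplacian src dst w in
      is_derive (sigma e ^+ 2) 1 (rho_of_var src dst w tau sigma e)
        (2^-1 * w e ^+ 2 *
         reff (L *m invmx (mxcos (tau *: L)) *m (centering R n - mxsin (tau *: L)))
              (src e) (dst e)).
Proof.
move=> _ conn w_gt0 tau_ge0 stable sigma sigma_gt0.
have [s [P [s_uniq P_neq0 LP P_sym P_sum]]] :=
  spectral_resolution (trmx_laplacian src dst w).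
split.
  exact: (h2_integral conn w_gt0 tau_ge0 stable s_uniq P_neq0 LP P_sym P_sum sigma).1.
move=> e L; rewrite (reff_delay conn w_gt0 tau_ge0 stable s_uniq P_neq0 LP P_sym P_sum).
exact: (is_derive_rho_of_var conn w_gt0 tau_ge0 stable s_uniq P_neq0 LP P_sym P_sum).
Qed.
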